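(* Let $b>0$, $l\ge -\frac12$, and let $q\in C[0,b]$ be a complex-valued function. Let $K$ and $R$ be the kernels associated with $q$ and $l$ as described in the context. Let $n$ be an arbitrary integer satisfying $n>l+1$. Then for $0<t<x\le b$, $$K(x,t)=\frac{2\sqrt{\pi}}{\Gamma\left(l+\frac32\right)}\,\frac{t^{l+1}}{\Gamma(n-l-1)}\left(-\frac{d}{2t\,dt}\right)^{n}\int_{t}^{x}(s^{2}-t^{2})^{n-l-2}\,s\,R(x,s)\,ds ,$$ where $\frac{d}{2t\,dt}$ denotes the operator $\frac{1}{2t}\frac{d}{dt}$.
   Context: Consider the perturbed Bessel equation $-u''+\left(\frac{l(l+1)}{x^2}+q(x)\right)u=\omega^2u$ on $(0,b]$. Let $\tilde y(\omega,x)=\Gamma\left(l+\frac32\right)2^{l+\frac12}\omega^{-l-\frac12}\sqrt{x}\,J_{l+\frac12}(\omega x)$ (equal to $x^{l+1}$ for $\omega=0$) be the regular solution of the unperturbed equation ($q\equiv0$) with $\tilde y\sim x^{l+1}$ as $x\to0$; here $J_\nu$ is the Bessel function of the first kind. It is known that there is a continuous kernel $K(x,t)$, $0\le t\le x\le b$, independent of $\omega$, with $K(x,x)=\frac12\int_0^xq(s)\,ds$, such that for every $\omega\in\mathbb{C}$ the function $$\tilde u(\omega,x)=\tilde y(\omega,x)+\int_0^xK(x,t)\,\tilde y(\omega,t)\,dt$$ is the regular solution of the perturbed Bessel equation with $\tilde u(\omega,x)\sim x^{l+1}$ as $x\to0$; $K$ is called the kernel of the transmutation operator. The kernel $R$ is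 the $\omega$-independent function for which $$\tilde u(\omega,x)=\tilde y(\omega,x)+\int_0^xR(x,t)\cos(\omega t)\,dt\quad\text{for all }\omega\in\mathbb{C};$$ it is known that it is given by $R(x,s)=\frac{2\Gamma\left(l+\frac32\right)}{\sqrt{\pi}\,\Gamma(l+1)}\int_s^xK(x,t)\,t^{-l}(t^2-s^2)^l\,dt$. *)

(* Defs.v *)
From HB Require Import structures.
From mathcomp Require Import all_boot all_order all_algebra.
From mathcomp Require Import all_classical all_reals all_analysis.
From mathcomp Require Import complex.
Import Order.TTheory GRing.Theory Num.Theory.
Import numFieldNormedType.Exports.

Set Implicit Arguments.
Unset Strict Implicit.
Unset Printing Implicit Defensive.

Local Open Scope classical_set_scope.
Local Open Scope ring_scope.
Local Open Scope complex_scope.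

(* [R[i]] carries no topology, measurable structure or normed-space structure
   over [R] in the libraries, so limits, continuity, derivatives and integrals
   of complex-valued functions are taken on real and imaginary parts. *)
Section ComplexValued.
Variable R : realType.
Local Notation mu := (@lebesgue_measure R).

Definition ccvg (T : Type) (F : set_system T) (f : T -> R[i]) (z : R[i]) : Prop :=
  complex.Re (f y) @[y --> F] --> complex.Re z /\
  complex.Im (f y) @[y --> F] --> complex.Im z.

Definition ccontinuous_on (T : topologicalType) (A : set T) (f : T -> R[i]) : Prop :=
  {within A, continuous (fun y => complex.Re (f y))} /\
  {within A, continuous (fun y => complex.Im (f y))}.

Definition cintegrable (A : set R) (f : R -> R[i]) : Prop :=
  mu.-integrable A (fun y => (complex.Re (f y))%:E) /\
  mu.-integrable A (fun y => (complex.Im (f y))%:E).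

Definition cintegral (A : set R) (f : R -> R[i]) : R[i] :=
  Rintegral mu A (fun y => complex.Re (f y)) +i*
  Rintegral mu A (fun y => complex.Im (f y)).

Definition cseries (u : nat -> R[i]) : R[i] :=
  limn (series (fun k => complex.Re (u k))) +i*
  limn (series (fun k => complex.Im (u k))).

(* Derivative at [x] relative to [A]: it is one-sided when [x] is an end point
   of the interval [A], and does not depend on the values of [f] outside [A]. *)
Definition has_cderiv (A : set R) (f : R -> R[i]) (x : R) (d : R[i]) : Prop :=
  ccvg (within A x^') (fun y => (f y - f x) / (y - x)%:C) d.

Definition cderivable (f : R -> R[i]) (t : R) : Prop :=
  derivable (fun y => complex.Re (f y)) t 1 /\
  derivable (fun y => complex.Im (f y)) t 1.

Definition cderive1 (f : R -> R[i]) (t : R) : R[i] :=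
  derive1 (fun y => complex.Re (f y)) t +i* derive1 (fun y => complex.Im (f y)) t.

End ComplexValued.

Section SpecialFunctions.
Variable R : realType.
Local Notation mu := (@lebesgue_measure R).

(* Euler's integral; used only for [0 < a]. *)
Definition Gamma (a : R) : R :=
  Rintegral mu `]0, +oo[ (fun t => t `^ (a - 1) * expR (- t)).

Definition cexp (z : R[i]) : R[i] :=
  (expR (complex.Re z))%:C * (cos (complex.Im z) +i* sin (complex.Im z)).

Definition ccos (z : R[i]) : R[i] :=
  (cexp ('i * z) + cexp (- ('i * z))) / 2%:R.

Definition cmod (z : R[i]) : R :=
  Num.sqrt (complex.Re z ^+ 2 + complex.Im z ^+ 2).

(* Principal argument, in ]-pi, pi], for [z != 0]. *)
Definition carg (z : R[i]) : R :=
  if 0 <= complex.Im z then acos (complex.Re z / cmod z)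
  else - acos (complex.Re z / cmod z).

(* Principal branch of [z ^ a], for [z != 0]. *)
Definition cpow (z : R[i]) (a : R) : R[i] :=
  cexp (a%:C * (ln (cmod z) +i* carg z)).

(* Bessel function of the first kind, for [z != 0] and [0 <= nu] (for which
   all the Gamma values are those of a convergent integral). *)
Definition besselJ (nu : R) (z : R[i]) : R[i] :=
  cseries (fun k : nat =>
    ((-1) ^+ k / (k`!%:R * Gamma (k%:R + nu + 1)))%:C *
    cpow (z / 2%:R) (k.*2%:R + nu)).

End SpecialFunctions.

Section Transmutation.
Variables (R : realType) (b l : R) (q : R -> R[i]).

Definition ytilde (w : R[i]) (x : R) : R[i] :=
  if w == 0 then (x `^ (l + 1))%:C
  else (Gamma (l + 3 / 2) * 2 `^ (l + 1 / 2))%:C * cpow w (- l - 1 / 2) *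
       (Num.sqrt x)%:C * besselJ (l + 1 / 2) (w * x%:C).

Definition solves_perturbed_bessel (w : R[i]) (u : R -> R[i]) : Prop :=
  exists u1 u2 : R -> R[i], forall x : R, 0 < x <= b ->
    [/\ has_cderiv `]0, b] u x (u1 x),
        has_cderiv `]0, b] u1 x (u2 x) &
        - u2 x + ((l * (l + 1) / x ^+ 2)%:C + q x) * u x = w ^+ 2 * u x].

Definition regular_solution (w : R[i]) (u : R -> R[i]) : Prop :=
  solves_perturbed_bessel w u /\
  ccvg 0^'+ (fun x => u x / (x `^ (l + 1))%:C) 1.

Definition utilde (K : R -> R -> R[i]) (w : R[i]) (x : R) : R[i] :=
  ytilde w x + cintegral `[0, x] (fun t => K x t * ytilde w t).

Record transmutation_kernel (K : R -> R -> R[i]) : Prop := {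
  transmutation_kernel_continuous :
    ccontinuous_on [set p : R * R | 0 <= p.2 /\ p.2 <= p.1 <= b]
                   (fun p => K p.1 p.2) ;
  transmutation_kernel_diagonal : forall x : R, 0 <= x <= b ->
    K x x = cintegral `[0, x] q / 2%:R ;
  transmutation_kernel_regular : forall w : R[i], regular_solution w (utilde K w)
}.

(* These conditions determine [Rk x] almost everywhere on [0, x]. *)
Record cosine_kernel (K Rk : R -> R -> R[i]) : Prop := {
  cosine_kernel_integrable : forall x : R, 0 < x <= b ->
    cintegrable `[0, x] (Rk x) ;
  cosine_kernel_representation : forall (w : R[i]) (x : R), 0 < x <= b ->
    utilde K w x = ytilde w x + cintegral `[0, x] (fun t => Rk x t * ccos (w * t%:C))
}.

End Transmutation.

Section Inversion.
Variable R : realType.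

(* The operator - d / (2 t dt). *)
Definition neg_ddt2 (f : R -> R[i]) (t : R) : R[i] :=
  - ((2 * t)^-1)%:C * cderive1 f t.

Definition abel_integrand (l : R) (n : nat) (g : R -> R[i]) (t s : R) : R[i] :=
  ((s ^+ 2 - t ^+ 2) `^ (n%:R - l - 2) * s)%:C * g s.

Definition abel_integral (l : R) (n : nat) (g : R -> R[i]) (x t : R) : R[i] :=
  cintegral `[t, x] (abel_integrand l n g t).

End Inversion.

(* Main.v *)
(* By Poisson's integral, [ytilde w t] is, up to a constant, the integral of
   [t^-l (t^2 - s^2)^l cos (w s)] over [0 < s < t].  By Fubini, the cosine
   integrals of [Rk x] coincide, for [w = j pi / x], with those of the Abel
   transform of [t^-l K x t].  The two functions are hence equal almost
   everywhere: cosine polynomials [(1 - u^N)^{b_N}] in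
   [u = (1 - cos (pi s / x)) / 2], with [b_N] close to [u(y)^-N], converge
   boundedly to the indicator function of [s < y].  Plugging this into the Abel
   integral, Fubini and Euler's Beta integral collapse it to a multiple of
   the integral of [(s^2 - t^2)^(n-1) s^-l K x s] over [t < s < x], on which each
   [- d / (2 t dt)] lowers the exponent by one until the fundamental theorem of
   calculus applies. *)

Require Import Defs.
From HB Require Import structures.
From mathcomp Require Import all_boot all_order all_algebra.
From mathcomp Require Import all_classical all_reals all_analysis.
From mathcomp Require Import measurable_realfun complex ring lra.
Import Order.TTheory GRing.Theory Num.Theory.
Import numFieldNormedType.Exports.

Set Implicit Arguments.
Unset Strict Implicit.
Unset Printing Implicit Defensive.

Local Open Scope classical_set_scope.
Local Open Scope ring_scope.
(** * Change of variables *)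

(** In the variable [t ^+ 2], integration against [(t^2 - s^2)^l] is a fractional integral of order
    [l + 1], and the weight of the theorem is one of order [n - l - 1]. Orders add under
    composition, so the total is the integer [n], which [n] applications of [- d / (2 t dt)] undo;
    [l + 1 < n] says that the second order is positive. The obstacle is that the cosine kernel is
    given only through integrals, hence only up to null sets, while the conclusion is pointwise:
    pointwise values come back at the last derivative, from the continuity of [K x]. The powers to
    be integrated are singular at end points, so the substitutions are proved for nonnegative
    measurable functions with values in the extended reals. At the real frequencies [j pi / x] both
    [ytilde] and the cosine are real, so the real and imaginary parts of the kernels are two
    separate real problems. *)

Section density.
Local Open Scope ereal_scope.
Context d (T : measurableType d) (R : realType) (mu nu : {measure set T -> \bar R}).
Variable f : T -> R.
Hypothesis mf : measurable_fun setT f.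
Hypothesis f0 : forall x, (0 <= f x)%R.
Hypothesis nuE : forall A, measurable A -> nu A = \int[mu]_(x in A) (f x)%:E.

Import HBNNSimple.

Lemma ge0_integral_density (g : T -> \bar R) :
  measurable_fun setT g -> (forall x, 0 <= g x) ->
  \int[nu]_x g x = \int[mu]_x (g x * (f x)%:E).
Proof.
move=> mg g0; pose h := nnsfun_approx measurableT mg.
have mfE : measurable_fun setT (fun x => (f x)%:E) by exact/measurable_EFinP.
have gE x : g x = limn (fun n => (h n x)%:E).
  by apply/esym/cvg_lim => //; exact: cvg_nnsfun_approx.
have gfE x : g x * (f x)%:E = limn (fun n => (h n x)%:E * (f x)%:E).
  apply/esym/cvg_lim => //; apply: cvgeZr => //; exact: cvg_nnsfun_approx.
transitivity (limn (fun n => \int[nu]_x (h n x)%:E)).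
  rewrite -monotone_convergence//.
  - by apply: eq_integral => x _; rewrite gE.
  - by move=> n; exact/measurable_EFinP/measurable_funP.
  - by move=> n x _; rewrite lee_fin.
  - by move=> x _ m n mn; rewrite lee_fin; exact/lefP/nd_nnsfun_approx.
transitivity (limn (fun n => \int[mu]_x ((h n x)%:E * (f x)%:E))); last first.
  rewrite -monotone_convergence//.
  - by apply: eq_integral => x _; rewrite gfE.
  - by move=> n; apply: emeasurable_funM => //; exact/measurable_EFinP/measurable_funP.
  - by move=> n x _; rewrite mule_ge0// lee_fin.
  - move=> x _ m n mn; rewrite lee_wpmul2r ?lee_fin//.
    exact/lefP/nd_nnsfun_approx.
congr (limn _); apply/funext => n.
transitivity (\int[nu]_x \sum_(y \in range (h n)) (y * \1_(h n @^-1` [set y]) x)%:E).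
  by apply: eq_integral => t _; rewrite /= fimfunE -fsumEFin.
have indich r : measurable_fun setT (fun x => (r * \1_(h n @^-1` [set r]) x)%:E).
  exact/measurable_EFinP/measurable_funM.
rewrite ge0_integral_fsum//; last by move=> m y _; exact: nnfun_muleindic_ge0.
transitivity (\int[mu]_x \sum_(y \in range (h n))
    (y * \1_(h n @^-1` [set y]) x)%:E * (f x)%:E); last first.
  apply: eq_integral => x _.
  rewrite -ge0_mule_fsuml => [|y]; last exact: nnfun_muleindic_ge0.
  by rewrite fsumEFin // -(fimfunE _ x).
rewrite ge0_integral_fsum//; last 2 first.
  - by move=> y; apply: emeasurable_funM.
  - by move=> m y Ey; apply: mule_ge0; [exact: nnfun_muleindic_ge0|rewrite lee_fin].
apply: eq_fsbigr => r rhn.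
have mhr : measurable (h n @^-1` [set r]) by [].
under eq_integral do rewrite EFinM.
rewrite integralZl_indic_nnsfun// integral_indic// setIT.
rewrite (eq_integral (fun x => r%:E * ((\1_(h n @^-1` [set r]) x)%:E * (f x)%:E))); last first.
  by move=> x _; rewrite EFinM muleA.
rewrite ge0_integralZl//; last 3 first.
- by apply: emeasurable_funM => //; exact/measurable_EFinP.
- by move=> t _; rewrite mule_ge0 ?lee_fin ?f0.
- by move: rhn; rewrite inE => -[t _ <-]; rewrite lee_fin.
rewrite nuE//; congr (_ * _); rewrite integral_mkcond.
apply: eq_integral => x _; rewrite patchE indicE muleC.
by case: ifPn => xr /=; rewrite ?mule1 ?mule0.
Qed.

End density.

Section change_of_variables.
Context (R : realType).
Local Notation mu := (@lebesgue_measure R).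
Variables (F f : R -> R).
Hypothesis Fincr : {homo F : x y / x < y}.
Hypothesis Fsurj : forall y, exists x, F x = y.
Hypothesis dF : forall x : R, is_derive x 1 F (f x).
Hypothesis cf : continuous f.
Hypothesis f0 : forall x, 0 <= f x.

Let mF : measurable_fun setT (F : measurableTypeR R -> measurableTypeR R).
Proof.
apply: continuous_measurable_fun => x.
by apply/differentiable_continuous/derivable1_diffP; case: (dF x).
Qed.

Let mf : measurable_fun setT (f : measurableTypeR R -> R).
Proof. exact: continuous_measurable_fun. Qed.

Definition density_measure (A : set (measurableTypeR R)) : \bar R := (\int[mu]_(x in A) (f x)%:E)%E.

Local Notation nu := density_measure.
Let nu0 : nu set0 = 0%E. Proof. by rewrite /density_measure integral_set0. Qed.
Let nu_ge0 A : (0 <= nu A)%E.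
Proof. by apply: integral_ge0 => x _; rewrite lee_fin. Qed.
Let nu_sigma : semi_sigma_additive nu.
Proof.
apply: semi_sigma_additive_nng_induced; first exact/measurable_EFinP.
by move=> x; rewrite lee_fin.
Qed.
HB.instance Definition _ := isMeasure.Build _ _ _ nu nu0 nu_ge0 nu_sigma.

Let F_mono : {mono F : x y / x < y}.
Proof. exact: (leW_mono (le_mono Fincr)). Qed.

(** Lebesgue measure is determined by its values on half-open intervals. The preimage of such an
    interval under the increasing bijection [F] is again one, and the fundamental theorem of
    calculus gives the integral of [f = F'] over it. *)
Let nu_preimage A : measurable A -> pushforward nu (F : _ -> measurableTypeR R) A = mu A.
Proof.
move=> mA; apply/esym/lebesgue_measure_unique => //= _ [[a b]] _ <-.
rewrite /pushforward /density_measure.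
have [a' Fa] := Fsurj a; have [b' Fb] := Fsurj b.
have -> : F @^-1` `]a, b] = `]a', b']%classic.
  apply/seteqP; split => s /=; rewrite !in_itv/= -Fa -Fb F_mono.
    by move=> /andP[-> ]; rewrite leNgt F_mono -leNgt.
  by move=> /andP[-> ]; rewrite (leNgt (F s)) F_mono -leNgt.
rewrite lebesgue_measure_itv/= lte_fin.
have mfE D : measurable_fun D (fun x : measurableTypeR R => (f x)%:E).
  by apply: measurable_funTS; exact/measurable_EFinP.
case: ltP => [ab|ba]; last first.
  by rewrite set_itv_ge ?integral_set0// bnd_simp -F_mono Fa Fb -leNgt.
have a'b' : a' < b' by rewrite -F_mono Fa Fb.
rewrite integral_itv_obnd_cbnd; last exact: mfE.
rewrite -Fa -Fb; apply/esym/continuous_FTC2 => //.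
- by apply: continuous_subspaceT => x; exact: cf.
- split => [x _||].
  + by case: (dF x).
  + apply: cvg_at_right_filter.
    by apply/differentiable_continuous/derivable1_diffP; case: (dF a').
  + apply: cvg_at_left_filter.
    by apply/differentiable_continuous/derivable1_diffP; case: (dF b').
- by move=> x _; rewrite derive1E; apply: derive_val.
Qed.

(** An identity of measures rather than of primitives, so that [g] may have singularities and [f]
    may vanish at points, as [2 * |x|] does at 0. *)
Lemma ge0_change_of_variables (g : R -> \bar R) :
  measurable_fun setT (g : measurableTypeR R -> \bar R) -> (forall x, 0 <= g x)%E ->
  (\int[mu]_x g x = \int[mu]_x (g (F x) * (f x)%:E))%E.
Proof.
move=> mg g0.
transitivity (\int[pushforward nu (F : _ -> measurableTypeR R)]_x g x)%E.
  by apply: eq_measure_integral => //= A mA _; rewrite -nu_preimage.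
rewrite ge0_integral_pushforward//= preimage_setT.
apply: (@ge0_integral_density _ _ R mu) => //=.
by apply: measurableT_comp mg mF.
Qed.
End change_of_variables.

(** * Affine and quadratic substitutions *)

Section substitutions.
Context (R : realType).
Local Notation mu := (@lebesgue_measure R).
Implicit Types (g : R -> \bar R) (x y c d : R).

Lemma ge0_integral_affine g c d : 0 < c ->
  measurable_fun setT (g : measurableTypeR R -> \bar R) -> (forall x, 0 <= g x)%E ->
  (\int[mu]_x g x = c%:E * \int[mu]_x g (c * x + d)%R)%E.
Proof.
move=> c0 mg g0.
have mh : measurable_fun setT ((fun x => g (c * x + d)) : measurableTypeR R -> \bar R).
  apply: (measurableT_comp mg).
  by apply: measurable_funD => //; exact: measurable_funM.
have dF x : is_derive x (1 : R) (fun x => c * x + d) c.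
  by apply: is_derive_eq; rewrite /GRing.scale/=; ring.
rewrite (@ge0_change_of_variables R (fun x => c * x + d) (fun=> c) _ _ dF)//.
- rewrite -ge0_integralZl//; last by rewrite lee_fin ltW.
  by apply: eq_integral => x _; rewrite muleC.
- by move=> x y xy; rewrite ltrD2r ltr_pM2l.
- by move=> y; exists ((y - d) / c); rewrite mulrC divfK ?subrK// gt_eqF.
- by move=> x; exact: cvg_cst.
- by move=> x; rewrite ltW.
Qed.

(* The extension of [x ^+ 2] to an increasing bijection of the real line. *)
Definition signed_sqr x : R := x * `|x|.

Lemma signed_sqrE x : 0 <= x -> signed_sqr x = x ^+ 2.
Proof. by move=> x0; rewrite /signed_sqr ger0_norm// expr2. Qed.

Lemma signed_sqrN x : signed_sqr (- x) = - signed_sqr x.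
Proof. by rewrite /signed_sqr normrN mulNr. Qed.

Lemma signed_sqr_gt0 x : (0 < signed_sqr x) = (0 < x).
Proof.
rewrite /signed_sqr; have [x0|x0|->] := ltgtP x 0.
- by rewrite nmulr_rgt0// normr_lt0.
- by rewrite pmulr_rgt0// normr_gt0 gt_eqF.
- by rewrite mul0r ltxx.
Qed.

Lemma ltr_signed_sqr : {homo signed_sqr : x y / x < y}.
Proof.
move=> x y xy; have [y0|y0] := ltP 0 y.
  have [x0|x0] := ltP 0 x.
    by rewrite !signed_sqrE ?ltW// ltr_pXn2r// nnegrE ltW.
  by rewrite (@le_lt_trans _ _ 0)// ?signed_sqr_gt0// leNgt signed_sqr_gt0 -leNgt.
rewrite -ltrN2 -!signed_sqrN !signed_sqrE ?oppr_ge0//; last exact: le_trans (ltW xy) y0.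
by rewrite ltr_pXn2r ?ltrN2// nnegrE oppr_ge0//; exact: le_trans (ltW xy) y0.
Qed.

Lemma is_derive_signed_sqr x : is_derive x (1 : R) signed_sqr (2 * `|x|).
Proof.
have [x0|x0|->] := ltgtP x 0.
- apply: (@near_eq_is_derive _ _ _ (fun y => - y ^+ 2)).
  + near=> y; have y0 : y < 0 by near: y; exact: lt_nbhsl.
    by rewrite /signed_sqr ltr0_norm// mulrN expr2.
  + apply: is_derive_eq; rewrite ltr0_norm// /GRing.scale/=; ring.
- apply: (@near_eq_is_derive _ _ _ (fun y => y ^+ 2)).
  + near=> y; have y0 : 0 < y by near: y; exact: lt_nbhsr.
    by rewrite /signed_sqr gtr0_norm// expr2.
  + apply: is_derive_eq; rewrite gtr0_norm// /GRing.scale/=; ring.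
(* Where the two branches meet, the difference quotient is [|h|]. *)
- have H : h^-1 *: (signed_sqr (h *: 1 + 0) - signed_sqr 0) @[h --> (0:R)^'] --> (0:R).
    apply/cvgrPdist_lt => e e0; near=> h.
    have h0 : h != 0 by near: h; exact: nbhs_dnbhs_neq.
    rewrite /signed_sqr /GRing.scale/= normr0 !mulr0 subr0 mulr1 addr0 sub0r normrN.
    rewrite mulrA mulVf// mul1r normr_id.
    by near: h; exact: dnbhs0_lt.
  rewrite normr0 mulr0; apply: DeriveDef; first by apply/cvg_ex; exists 0.
  exact: cvg_lim.
Unshelve. all: by end_near. Qed.

Lemma ge0_integral_signed_sqr g :
  measurable_fun setT (g : measurableTypeR R -> \bar R) -> (forall x, 0 <= g x)%E ->
  (\int[mu]_x g x = \int[mu]_x (g (signed_sqr x) * (2 * `|x|)%:E))%E.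
Proof.
move=> mg g0; apply: ge0_change_of_variables => //.
- exact: ltr_signed_sqr.
- move=> y; exists (if 0 <= y then Num.sqrt y else - Num.sqrt (- y)).
  case: (leP 0 y) => [y0|/ltW y0]; first by rewrite signed_sqrE ?sqr_sqrtr.
  by rewrite signed_sqrN signed_sqrE// sqr_sqrtr ?oppr_ge0// opprK.
- exact: is_derive_signed_sqr.
- move=> x; apply: cvgM; first exact: cvg_cst.
  exact: norm_continuous.
Qed.
End substitutions.

(** * Gamma and Beta functions *)

Section gamma_beta.
Context (R : realType).
Local Notation mu := (@lebesgue_measure R).
Implicit Types (a b x y t r : R).

(* Unlike [powR], it vanishes on all [y <= 0] ([0 `^ 0 = 1], and [y `^ a = 1] for
   [y < 0]), so that the integrals below can range over the whole line. *)
Definition tpow a y : R := if 0 < y then y `^ a else 0.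

Lemma tpow_ge0 a y : 0 <= tpow a y.
Proof. by rewrite /tpow; case: ifP => // _; exact: powR_ge0. Qed.

Lemma tpowE a y : 0 < y -> tpow a y = y `^ a.
Proof. by rewrite /tpow => ->. Qed.

Lemma tpow_le0 a y : y <= 0 -> tpow a y = 0.
Proof. by rewrite /tpow ltNge => ->. Qed.

Lemma measurable_tpow a : measurable_fun setT (tpow a : measurableTypeR R -> R).
Proof.
apply: measurable_fun_ifT => //; exact: measurable_fun_ltr.
Qed.

Lemma measurable_tpow_comp d (T : measurableType d) a (f : T -> R) :
  measurable_fun setT f -> measurable_fun setT (fun z : T => tpow a (f z)).
Proof. exact: measurableT_comp (measurable_tpow a). Qed.

Lemma tpowM a c y : 0 < c -> tpow a (c * y) = c `^ a * tpow a y.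
Proof.
move=> c0; rewrite /tpow pmulr_rgt0//; case: ifP => [y0|_]; last by rewrite mulr0.
by rewrite powRM// ltW.
Qed.

(** With values in the extended reals, the identities below follow from Tonelli's theorem alone;
    finiteness and positivity are deduced from them afterwards. *)
Definition eGamma a : \bar R := (\int[mu]_t (tpow (a - 1) t * expR (- t))%:E)%E.
Definition eBeta a b : \bar R :=
  (\int[mu]_u (tpow (a - 1) u * tpow (b - 1) (1 - u))%:E)%E.

Let mexpN : measurable_fun setT (fun t : measurableTypeR R => expR (- t)).
Proof. exact: measurableT_comp. Qed.

Lemma measurable_tpow_sub a r : measurable_fun setT (fun t : measurableTypeR R => tpow a (r - t)).
Proof. by apply: measurable_tpow_comp; exact: measurable_funB. Qed.

(** Scaling [t = r * u] extracts the power of [r]. Since [tpow] vanishes at nonpositive arguments,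
    the line is clipped to []0, r[]. *)
Lemma integral_tpow_conv a b r :
  (\int[mu]_t (tpow (a - 1) t * tpow (b - 1) (r - t))%:E =
   (tpow (a + b - 1) r)%:E * eBeta a b)%E.
Proof.
have [r0|r0] := leP r 0.
  rewrite tpow_le0// mul0e integral0_eq// => t _.
  have [t0|t0] := leP t 0; first by rewrite tpow_le0// mul0r.
  by rewrite (@tpow_le0 (b - 1)) ?mulr0// subr_le0 (le_trans r0)// ltW.
have mg s : measurable_fun setT (fun t : measurableTypeR R =>
    (tpow (a - 1) t * tpow (b - 1) (s - t))%:E).
  apply/measurable_EFinP/measurable_funM; [exact: measurable_tpow|exact: measurable_tpow_sub].
have g0 s t : (0 <= (tpow (a - 1) t * tpow (b - 1) (s - t))%:E)%E.
  by rewrite lee_fin mulr_ge0// tpow_ge0.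
rewrite (ge0_integral_affine 0 r0 (mg r) (g0 r)).
have -> : (tpow (a + b - 1) r)%:E = (r%:E * (r `^ (a - 1) * r `^ (b - 1))%:E)%E.
  rewrite -EFinM tpowE// -powRD; last by rewrite (gt_eqF r0) implybT.
  rewrite -{2}(powRr1 (ltW r0)) -powRD; last by rewrite (gt_eqF r0) implybT.
  by congr (_ `^ _)%:E; ring.
rewrite -muleA; congr (_ * _)%E.
rewrite -ge0_integralZl; [|by []|exact: (mg 1)|by []|]; last first.
  by rewrite lee_fin mulr_ge0// powR_ge0.
apply: eq_integral => t _; rewrite addr0 -EFinM; congr EFin.
have -> : r - r * t = r * (1 - t) by ring.
by rewrite !tpowM//; ring.
Qed.

(** With [r] the sum of the two variables, the exponentials combine to [expR (- r)] and the powers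
    form a convolution, evaluated by [integral_tpow_conv]. *)
Lemma eGammaM a b : (eGamma a * eGamma b = eGamma (a + b) * eBeta a b)%E.
Proof.
have mga c : measurable_fun setT (fun t : measurableTypeR R => (tpow (c - 1) t * expR (- t))%:E).
  apply/measurable_EFinP/measurable_funM; [exact: measurable_tpow|exact: mexpN].
have ga0 c t : (0 <= (tpow (c - 1) t * expR (- t))%:E)%E.
  by rewrite lee_fin mulr_ge0 ?tpow_ge0 ?expR_ge0.
have Gge0 c : (0 <= eGamma c)%E by apply: integral_ge0 => t _; exact: ga0.
rewrite {1}/eGamma -ge0_integralZr//.
transitivity (\int[mu]_t \int[mu]_r
   (tpow (a - 1) t * tpow (b - 1) (r - t) * expR (- r))%:E)%E.
  apply: eq_integral => t _.
  rewrite /eGamma (@ge0_integral_affine _ _ 1 (- t))// mul1e -ge0_integralZl//.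
  - apply: eq_integral => r _; rewrite -EFinM mul1r; congr EFin.
    have -> : expR (- r) = expR (- t) * expR (- (r - t)) by rewrite -expRD; congr expR; ring.
    by ring.
  - apply: (measurableT_comp (mga b)).
    by apply: measurable_funD => //; exact: measurable_funM.
rewrite (fubini_tonelli (fun z : measurableTypeR R * measurableTypeR R =>
  (tpow (a - 1) z.1 * tpow (b - 1) (z.2 - z.1) * expR (- z.2))%:E))/=; last 2 first.
- apply/measurable_EFinP; apply: measurable_funM; first apply: measurable_funM.
  + by apply: measurable_tpow_comp.
  + by apply: measurable_tpow_comp; exact: measurable_funB.
  + by apply: measurableT_comp => //; exact: measurableT_comp.
- by move=> z; rewrite lee_fin !mulr_ge0 ?tpow_ge0 ?expR_ge0.
rewrite muleC -ge0_integralZl//; last by apply: integral_ge0 => t _; rewrite lee_fin mulr_ge0 ?tpow_ge0.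
apply: eq_integral => r _.
rewrite muleC EFinM -muleA (muleC (expR _)%:E) muleA -integral_tpow_conv.
rewrite -ge0_integralZr//.
- apply/measurable_EFinP/measurable_funM; [exact: measurable_tpow|exact: measurable_tpow_sub].
- by move=> t _; rewrite lee_fin mulr_ge0// tpow_ge0.
Qed.

Lemma integral_itv_if (i : interval R) (f : R -> \bar R) :
  (\int[mu]_(t in [set` i]) f t = \int[mu]_t (if t \in i then f t else 0))%E.
Proof.
rewrite integral_mkcond; apply: eq_integral => t _; rewrite patchE.
have [ti|ti] := boolP (t \in i); first by rewrite mem_set.
by rewrite memNset//; exact/negP.
Qed.

Lemma eGammaE a : eGamma a = (\int[mu]_(t in `]0%R, +oo[) (t `^ (a - 1) * expR (- t))%:E)%E.
Proof.
rewrite integral_itv_if; apply: eq_integral => t _; rewrite in_itv/= andbT.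
by case: ltP => t0; [rewrite tpowE|rewrite tpow_le0 ?mul0r].
Qed.

Lemma integral_powR_itv a e : 0 < a -> 0 < e < 1 ->
  (\int[mu]_(u in `[e, 1%R]) (u `^ (a - 1))%:E = ((1 - e `^ a) / a)%:E)%E.
Proof.
move=> a0 /andP[e0 e1].
have dF (u : R) : 0 < u -> is_derive u (1 : R) (fun v => v `^ a / a) (u `^ (a - 1)).
  move=> u0; have := is_derive1_powR a u0 => ?.
  by apply: is_derive_eq; rewrite /GRing.scale/= mulr0 add0r mulrA mulVf ?mul1r// gt_eqF.
have cF (u : R) : 0 < u -> {for u, continuous (fun v => v `^ a / a)}.
  by move=> u0; apply/differentiable_continuous/derivable1_diffP; case: (dF u u0).
have cf (u : R) : 0 < u -> {for u, continuous (fun v : R => v `^ (a - 1))}.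
  move=> u0; apply/differentiable_continuous/derivable1_diffP.
  by case: (is_derive1_powR (a - 1) u0).
rewrite (@continuous_FTC2 _ _ (fun v => v `^ a / a))//.
- by rewrite -EFinB powR1 -mulrBl.
- apply: continuous_in_subspaceT => u; rewrite inE/= in_itv/= => /andP[eu _].
  by apply: cf; exact: lt_le_trans eu.
- split.
  + move=> u; rewrite in_itv/= => /andP[eu _].
    by case: (dF u (lt_trans e0 eu)).
  + by apply: cvg_at_right_filter; apply: cF.
  + by apply: cvg_at_left_filter; apply: cF.
- move=> u; rewrite in_itv/= => /andP[eu _].
  by rewrite derive1E; have := dF u (lt_trans e0 eu) => ?; exact: derive_val.
Qed.

(* With [eGammaM] and [eGamma1], this gives the functional equation of Gamma. *)
Lemma eBetar1 a : 0 < a -> eBeta a 1 = (a^-1)%:E.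
Proof.
move=> a0; pose f (u : measurableTypeR R) := (u `^ (a - 1))%:E.
have mf : measurable_fun setT f by apply/measurable_EFinP; exact: measurable_powR.
transitivity (\int[mu]_(u in `]0%R, 1%R[) f u)%E.
  rewrite integral_itv_if; apply: eq_integral => u _; rewrite in_itv/= /f.
  have [u0|u0] := leP u 0; first by rewrite tpow_le0// mul0r.
  have [u1|u1] := leP 1 u; first by rewrite (@tpow_le0 (1 - 1)) ?mulr0// subr_le0.
  by rewrite !tpowE ?subr_gt0// subrr powRr0 mulr1.
rewrite integral_itv_bndo_bndc; last exact: measurable_funS mf.
(* The left ends start at [1 / 2], since [integral_powR_itv] wants them strictly below 1. *)
pose A n : set (measurableTypeR R) := [set` `[(n.+2%:R : R)^-1, (1 : R)]].
have -> : `]0%R, 1%R]%classic = \bigcup_n A n.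
  apply/seteqP; split => u /=; rewrite in_itv/=.
    move=> /andP[u0 u1]; exists (Num.truncn u^-1) => //; rewrite /A/= in_itv/= u1 andbT.
    rewrite invf_ple ?posrE//; apply: le_trans (ltW (truncnS_gt _)) _.
    by rewrite ler_nat.
  move=> [n _]; rewrite /A/= in_itv/= => /andP[nu ->]; rewrite andbT.
  by apply: lt_le_trans nu; rewrite invr_gt0.
have cA := @ge0_nondecreasing_set_cvg_integral _ (measurableTypeR R) R A f mu.
have {}cA : (\int[mu]_(x in A i) f x @[i --> \oo] --> \int[mu]_(x in \bigcup_i A i) f x)%E.
  apply: cA.
  - apply/nondecreasing_seqP => n; rewrite subsetEset => u; rewrite /A/= !in_itv/= => /andP[h ->].
    by rewrite andbT; apply: le_trans h; rewrite lef_pV2 ?posrE// ler_nat.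
  - by move=> i; exact: measurable_itv.
  - by move=> i; exact: measurable_funS mf.
  - by move=> i u _; rewrite lee_fin powR_ge0.
rewrite -(cvg_lim _ cA)//; apply: cvg_lim => //.
have -> : (fun n => \int[mu]_(x in A n) f x)%E = EFin \o (fun n => (1 - (n.+2%:R^-1) `^ a) / a).
  apply/funext => n; rewrite /A /f integral_powR_itv// invr_gt0 ltr0n/=.
  by rewrite invf_lt1// ltr1n.
apply: cvg_EFin; first by near=> n.
rewrite -[X in _ --> X]mul1r; apply: cvgMl.
rewrite -[X in _ --> X]subr0; apply: cvgB; first exact: cvg_cst.
move: (powR_cvg0 a0) => /cvg_at_rightP; apply; split.
  by move=> n; rewrite invr_gt0.
have := @cvg_harmonic R; rewrite -cvg_shiftS; apply: cvg_trans.
by apply: near_eq_cvg; near=> n.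
Unshelve. all: by end_near. Qed.

Lemma eGamma1 : eGamma 1 = 1%E.
Proof.
rewrite -(@integral_exponential_pdf R 1 ltr01) eGammaE.
rewrite integral_itv_obnd_cbnd; last first.
  apply/measurable_funTS/measurable_EFinP/measurable_funM; last exact: mexpN.
  exact: measurable_powR.
rewrite integral_mkcond; apply: eq_integral => t _; rewrite /exponential_pdf !patchE.
by case: ifP => _ //; rewrite subrr powRr0 !mul1r mulN1r.
Qed.

(** Substituting a square turns the integrand into twice the Gauss function on the positive
    half-line. *)
Lemma eGamma_half : eGamma (1 / 2) = (Num.sqrt pi)%:E.
Proof.
have mg : measurable_fun setT (fun t : measurableTypeR R => (tpow (1 / 2 - 1) t * expR (- t))%:E).
  by apply/measurable_EFinP/measurable_funM; [exact: measurable_tpow|exact: mexpN].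
rewrite /eGamma ge0_integral_signed_sqr//; last by move=> t; rewrite lee_fin mulr_ge0 ?tpow_ge0 ?expR_ge0.
transitivity (\int[mu]_(x in `]0%R, +oo[) (2%:E * (gauss_fun x)%:E))%E.
  rewrite integral_itv_if; apply: eq_integral => t _; rewrite in_itv/= andbT.
  case: ltP => t0.
    rewrite tpowE ?signed_sqr_gt0// signed_sqrE ?ltW// -EFinM gtr0_norm// -EFinM /gauss_fun.
    rewrite -powR_mulrn ?ltW// -powRrM.
    have -> : 2%:R * (1 / 2 - 1) = -1 :> R by field.
    rewrite powR_inv1 ?ltW//; congr EFin; field; exact: lt0r_neq0.
  by rewrite tpow_le0 ?mul0r ?mul0e// leNgt signed_sqr_gt0 -leNgt.
have mG : measurable_fun setT (fun t : measurableTypeR R => (gauss_fun t)%:E).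
  by apply/measurable_EFinP; exact: measurable_gauss_fun.
rewrite ge0_integralZl//; last 2 first.
- exact: measurable_funS mG.
- by move=> t _; rewrite lee_fin gauss_fun_ge0.
rewrite integral_itv_obnd_cbnd; last exact: measurable_funS mG.
by rewrite integral0y_gauss -EFinM; congr EFin; field.
Qed.

Lemma eGammaS a : 0 < a -> eGamma (a + 1) = (a%:E * eGamma a)%E.
Proof.
move=> a0; have := eGammaM a 1; rewrite eGamma1 mule1 eBetar1// => ->.
by rewrite muleCA -EFinM mulfV ?gt_eqF// mule1.
Qed.

Let mga c : measurable_fun setT (fun t : measurableTypeR R => (tpow (c - 1) t * expR (- t))%:E).
Proof. by apply/measurable_EFinP/measurable_funM; [exact: measurable_tpow|exact: mexpN]. Qed.

Let ga0 c t : (0 <= (tpow (c - 1) t * expR (- t))%:E)%E.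
Proof. by rewrite lee_fin mulr_ge0 ?tpow_ge0 ?expR_ge0. Qed.

Lemma eGamma_ge0 a : (0 <= eGamma a)%E.
Proof. by apply: integral_ge0. Qed.

Lemma eGamma_nat_lty n : (eGamma n.+1%:R < +oo)%E.
Proof.
elim: n => [|n ih]; first by rewrite eGamma1 ltry.
rewrite -natr1 eGammaS//; apply: lte_mul_pinfty => //.
Qed.

(** By the functional equation it is enough to treat [a + 1], whose integrand has no singularity at
    0: there [t ^ a <= 1 + t ^ n] for a natural number [n > a]. *)
Lemma eGamma_lty a : 0 < a -> (eGamma a < +oo)%E.
Proof.
move=> a0.
suff : (eGamma (a + 1) < +oo)%E.
  rewrite eGammaS//; apply: contraTT; rewrite -!leNgt !leye_eq => /eqP ->.
  by rewrite gt0_muley// lte_fin.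
pose n := (Num.truncn a).+1.
apply: (@le_lt_trans _ _ (eGamma 1 + eGamma n.+1%:R)%E); last first.
  by rewrite eGamma1 lte_add_pinfty ?ltry// eGamma_nat_lty.
rewrite -ge0_integralD//; apply: ge0_le_integral => //.
- by apply: emeasurable_funD.
move=> t _; rewrite -EFinD lee_fin -mulrDl ler_wpM2r ?expR_ge0//.
have [t0|t0] := leP t 0; first by rewrite !tpow_le0// addr0.
rewrite !tpowE// subrr powRr0 addrK -natr1 addrK.
have [t1|t1] := leP t 1.
  rewrite -[leLHS]addr0 lerD ?powR_ge0// -(powRr0 t).
  by apply: ger_powR; [rewrite t0 t1|exact: ltW].
rewrite -[leLHS]add0r lerD// ler_powR ?ltW//.
exact: truncnS_gt.
Qed.

Lemma eGamma_gt0 a : 0 < a -> (0 < eGamma a)%E.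
Proof.
move=> a0.
(* The shifted exponent is positive, so the power is at least 1 on [[1, 2]]. *)
suff : (0 < eGamma (a + 1))%E.
  by rewrite eGammaS//; apply: contraTT; rewrite -!leNgt => ?; rewrite mule_ge0_le0// lee_fin ltW.
apply: (@lt_le_trans _ _ (\int[mu]_(t in `[1%R, 2%R]) (expR (- 2))%:E)%E).
  rewrite integral_cst//= lebesgue_measure_itv/= lte_fin ltr1n -EFinB -EFinM lte_fin.
  by rewrite mulr_gt0 ?expR_gt0//; lra.
apply: (@le_trans _ _ (\int[mu]_(t in `[1%R, 2%R]) (tpow (a + 1 - 1) t * expR (- t))%:E)%E); last first.
  by apply: ge0_subset_integral => //; exact: mga.
apply: ge0_le_integral => //.
- exact: measurable_funS (mga _).
move=> t; rewrite /= in_itv/= => /andP[t1 t2]; rewrite lee_fin addrK tpowE; last exact: lt_le_trans t1.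
rewrite -[leLHS]mul1r ler_pM ?expR_ge0// ?ler_expR ?lerN2//.
rewrite -(powRr0 t); apply: ler_powR => //; exact: ltW.
Qed.

Lemma EFin_Gamma a : 0 < a -> (Gamma a)%:E = eGamma a.
Proof.
move=> a0; rewrite /Gamma /Rintegral -eGammaE fineK// ge0_fin_numE ?eGamma_ge0//.
exact: eGamma_lty.
Qed.

Lemma Gamma_gt0 a : 0 < a -> 0 < Gamma a.
Proof. by move=> a0; rewrite -lte_fin EFin_Gamma// eGamma_gt0. Qed.

Lemma GammaS a : 0 < a -> Gamma (a + 1) = a * Gamma a.
Proof.
move=> a0; apply: EFin_inj; rewrite EFinM !EFin_Gamma// ?eGammaS//.
by rewrite addr_gt0.
Qed.

Lemma Gamma1 : Gamma (1 : R) = 1.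
Proof. by apply: EFin_inj; rewrite EFin_Gamma// eGamma1. Qed.

Lemma Gamma_half : Gamma (1 / 2 : R) = Num.sqrt pi.
Proof. by apply: EFin_inj; rewrite EFin_Gamma// eGamma_half. Qed.

Lemma Gamma_nat n : Gamma (n.+1%:R : R) = n`!%:R.
Proof.
elim: n => [|n ih]; first by rewrite Gamma1.
by rewrite -natr1 GammaS// ih factS natrM.
Qed.

(** The quotient of Gamma values serves as the definition; [eBetaE] identifies it with Euler's
    integral. *)
Definition Beta a b := Gamma a * Gamma b / Gamma (a + b).

Lemma Beta_gt0 a b : 0 < a -> 0 < b -> 0 < Beta a b.
Proof.
move=> a0 b0; have ab0 := addr_gt0 a0 b0.
by rewrite /Beta divr_gt0 ?mulr_gt0 ?Gamma_gt0.
Qed.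

Lemma eBetaE a b : 0 < a -> 0 < b -> eBeta a b = (Beta a b)%:E.
Proof.
move=> a0 b0; have ab0 := addr_gt0 a0 b0; have := eGammaM a b.
rewrite -!EFin_Gamma// -EFinM /Beta => /esym.
have : (0 <= eBeta a b)%E.
  by apply: integral_ge0 => u _; rewrite lee_fin mulr_ge0 ?tpow_ge0.
have G0 := Gamma_gt0 ab0.
case: (eBeta a b) => [x _|_|//].
- by rewrite -EFinM => -[<-]; rewrite mulrAC mulfV ?mul1r// gt_eqF.
- by rewrite gt0_muley// lte_fin.
Qed.

End gamma_beta.

(** * Abel kernels and the cosine series *)

Section abel_kernel.
Context (R : realType).
Local Notation mu := (@lebesgue_measure R).
Local Notation mR := (measurableTypeR R).
Implicit Types (a l w c s t : R).

(** The kernel of Poisson's integral without its constant and the factor [t ^ -l], extended by zero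
    to the whole line; for [t > 0] it is supported in [0 < s < t]. *)
Definition kern l t s : R := if 0 < s then tpow l (t ^+ 2 - s ^+ 2) else 0.

(* [abelw (k + 1 / 2) 0 s] is [s ^+ k.*2], and [abelw (n - l - 1) (t ^+ 2) s] is the
   weight of the Abel integral of the theorem. *)
Definition abelw a c s : R := if 0 < s then tpow (a - 1) (s ^+ 2 - c) * s else 0.

Lemma kern_ge0 l t s : 0 <= kern l t s.
Proof. by rewrite /kern; case: ifP => // _; exact: tpow_ge0. Qed.

Lemma abelw_ge0 a c s : 0 <= abelw a c s.
Proof. by rewrite /abelw; case: ifP => // s0; rewrite mulr_ge0 ?tpow_ge0// ltW. Qed.

Lemma measurable_kern2 l :
  measurable_fun setT (fun z : mR * mR => kern l z.2 z.1).
Proof.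
apply: measurable_fun_ifT => //; first exact: measurable_fun_ltr.
apply: measurable_tpow_comp; apply: measurable_funB; exact: measurable_funX.
Qed.

Lemma measurable_kern l t : measurable_fun setT (kern l t : mR -> R).
Proof.
apply: measurable_fun_ifT => //; first exact: measurable_fun_ltr.
apply: measurable_tpow_comp; apply: measurable_funB => //; exact: measurable_funX.
Qed.

Lemma measurable_abelw a c : measurable_fun setT (abelw a c : mR -> R).
Proof.
apply: measurable_fun_ifT => //; first exact: measurable_fun_ltr.
apply: measurable_funM => //; apply: measurable_tpow_comp.
by apply: measurable_funB => //; exact: measurable_funX.
Qed.

(** In the variable [y = s ^+ 2] the integrand is [(y - c)^(a - 1) (t^2 - y)^l], a Beta integral
    after a shift by [c]; the factor [1 / 2] is the Jacobian. As [c >= 0], negative [y] contribute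
    nothing. *)
Lemma integral_abelw_kern a c l t : 0 < a -> -1 < l -> 0 <= c ->
  (\int[mu]_s (abelw a c s * kern l t s)%:E =
   (tpow (a + l) (t ^+ 2 - c) * Beta a (l + 1) / 2)%:E)%E.
Proof.
move=> a0 l1 c0.
have l0 : 0 < l + 1 by rewrite -ltrBlDr sub0r.
pose g y : \bar R := (tpow (a - 1) (y - c) * tpow l (t ^+ 2 - y))%:E.
have mg : measurable_fun setT (g : mR -> \bar R).
  apply/measurable_EFinP/measurable_funM; last exact: measurable_tpow_sub.
  by apply: measurable_tpow_comp; exact: measurable_funB.
have g0 y : (0 <= g y)%E by rewrite lee_fin mulr_ge0 ?tpow_ge0.
have I1 : (\int[mu]_y g y = (tpow (a + l) (t ^+ 2 - c) * Beta a (l + 1))%:E)%E.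
  rewrite (ge0_integral_affine c ltr01 mg g0) mul1e EFinM -eBetaE//.
  rewrite (_ : a + l = a + (l + 1) - 1); last by ring.
  rewrite -integral_tpow_conv; apply: eq_integral => y _.
  by rewrite /g mul1r !addrK opprD addrCA addrC.
have I2 : (\int[mu]_y g y = 2%:E * \int[mu]_s (abelw a c s * kern l t s)%:E)%E.
  rewrite (ge0_integral_signed_sqr mg g0) -ge0_integralZl//; last 2 first.
  - by apply/measurable_EFinP/measurable_funM; [exact: measurable_abelw|exact: measurable_kern].
  - by move=> s _; rewrite lee_fin mulr_ge0 ?abelw_ge0 ?kern_ge0.
  apply: eq_integral => s _; rewrite -!EFinM /abelw /kern; congr EFin.
  case: ltP => s0; first by rewrite signed_sqrE ?ltW// gtr0_norm//; ring.
  rewrite tpow_le0 ?mul0r ?mulr0// subr_le0 (le_trans _ c0)//.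
  by rewrite leNgt signed_sqr_gt0 -leNgt.
move: I2; rewrite I1 => /(congr1 (fun u => (2^-1)%:E * u)%E).
by rewrite (muleA _ 2%:E) -(EFinM _ 2) mulVf// mul1e => <-; rewrite -EFinM mulrC.
Qed.

Lemma integrable_abelw_kern a c l t : 0 < a -> -1 < l -> 0 <= c ->
  mu.-integrable setT (fun s : mR => (abelw a c s * kern l t s)%:E).
Proof.
move=> a0 l1 c0; apply/integrableP; split.
  by apply/measurable_EFinP/measurable_funM; [exact: measurable_abelw|exact: measurable_kern].
under eq_integral do rewrite /= ger0_norm ?mulr_ge0 ?abelw_ge0 ?kern_ge0//.
by rewrite integral_abelw_kern// ltry.
Qed.

Lemma abelw_half n s : abelw (n%:R + 1 / 2) 0 s = if 0 < s then s ^+ n.*2 else 0.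
Proof.
rewrite /abelw; case: ltP => // s0; rewrite subr0 tpowE ?exprn_gt0//.
rewrite -powR_mulrn ?ltW// -powRrM -{2}(powRr1 (ltW s0)) -powRD; last by rewrite (gt_eqF s0) implybT.
rewrite -powR_mulrn ?ltW// -mul2n natrM; congr (_ `^ _); by field.
Qed.

Lemma integrable_kern l t : -1 < l -> mu.-integrable setT (fun s : mR => (kern l t s)%:E).
Proof.
move=> l1; have h0 : 0 < 0%:R + 1 / 2 :> R by rewrite add0r divr_gt0.
apply: eq_integrable (integrable_abelw_kern t h0 l1 (lexx 0)) => // s _.
by rewrite abelw_half /kern; case: ltP => _; rewrite ?mul1r ?mul0r.
Qed.

(** As [k! <= (2k)!], the terms are dominated by those of the series of [expR (x ^+ 2)]. The bound
    does not depend on [n], as dominated convergence requires. *)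
Lemma normr_series_cos_coeff' (x : R) n : `|series (cos_coeff' x) n| <= expR (x ^+ 2).
Proof.
apply: (@le_trans _ _ (series (exp_coeff (x ^+ 2)) n)).
  rewrite /series/= (le_trans (ler_norm_sum _ _ _))// ler_sum// => k _.
  rewrite /cos_coeff' -exprnP normrM normrM normrX normrN1 expr1n mul1r normrX.
  rewrite normfV normr_nat -mul2n exprM real_normK ?num_real//.
  apply: ler_wpM2l; first by rewrite exprn_ge0 ?sqr_ge0.
  rewrite lef_pV2 ?posrE ?ltr0n ?fact_gt0//.
  by rewrite ler_nat leq_fact// leq_pmull.
apply: nondecreasing_cvgn_le; last exact: is_cvg_series_exp_coeff.
apply/nondecreasing_seqP => k; rewrite seriesSr lerDl /exp_coeff.
by rewrite divr_ge0// exprn_ge0// sqr_ge0.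
Qed.

(** Termwise integration of the cosine series, each term being a Beta integral. The resulting series
    is, up to a factor, that of the Bessel function. *)
Lemma cvg_series_cos_kern l w t : -1 < l -> 0 < t ->
  series (fun k => (-1) ^+ k * w ^+ k.*2 / k.*2`!%:R *
    (tpow (k%:R + 1 / 2 + l) (t ^+ 2) * Beta (k%:R + 1 / 2) (l + 1) / 2)) @ \oo -->
  Rintegral mu setT (fun s => cos (w * s) * kern l t s).
Proof.
move=> l1 t0.
have h0 k : 0 < k%:R + 1 / 2 :> R by rewrite ltr_wpDl// divr_gt0.
pose f_ n (s : mR) : \bar R := (series (cos_coeff' (w * s)) n * kern l t s)%:E.
have f_E n s : f_ n s = (\sum_(0 <= k < n) ((-1) ^+ k * w ^+ k.*2 / k.*2`!%:R)%:E *
    (abelw (k%:R + 1 / 2) 0 s * kern l t s)%:E)%E.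
  rewrite /f_ /series/= mulr_suml -sumEFin; apply: eq_bigr => k _.
  rewrite -EFinM abelw_half /kern /cos_coeff' -exprnP exprMn; congr EFin.
  by case: ltP => _; rewrite ?mulr0//; ring.
have intk k : mu.-integrable setT (fun s : mR => ((-1) ^+ k * w ^+ k.*2 / k.*2`!%:R)%:E *
    (abelw (k%:R + 1 / 2) 0 s * kern l t s)%:E)%E.
  exact/integrableZl/integrable_abelw_kern.
have mf_ n : measurable_fun setT (f_ n).
  rewrite (_ : f_ n = (fun s => \sum_(0 <= k < n) ((-1) ^+ k * w ^+ k.*2 / k.*2`!%:R)%:E *
    (abelw (k%:R + 1 / 2) 0 s * kern l t s)%:E)%E); last exact/funext.
  by apply: emeasurable_sum => k; exact: measurable_int (intk k).
have mf : measurable_fun setT (fun s : mR => (cos (w * s) * kern l t s)%:E).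
  apply/measurable_EFinP/measurable_funM; last exact: measurable_kern.
  apply: (measurableT_comp (continuous_measurable_fun (@continuous_cos R))).
  exact: measurable_funM.
have cf : {ae mu, forall s : mR, setT s -> f_ ^~ s @ \oo --> (cos (w * s) * kern l t s)%:E}.
  apply/aeW => s _; apply: cvg_EFin; first by near=> n.
  by apply: cvgMl; exact: cvg_cos_coeff'.
(* On the support of the kernel [s < t], so [w * t] can replace [w * s] in the exponential bound. *)
pose g (s : mR) : \bar R := ((expR ((w * t) ^+ 2))%:E * (kern l t s)%:E)%E.
have ig : mu.-integrable setT g by exact/integrableZl/integrable_kern.
have fg : {ae mu, forall (s : mR) n, setT s -> (`|f_ n s| <= g s)%E}.
  apply/aeW => s n _; rewrite /f_ /g -EFinM lee_fin normrM (ger0_norm (kern_ge0 _ _ _)).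
  rewrite /kern; case: ltP => s0; last by rewrite !mulr0.
  have [d0|d0] := leP (t ^+ 2 - s ^+ 2) 0; first by rewrite tpow_le0// !mulr0.
  rewrite ler_wpM2r ?tpow_ge0// (le_trans (normr_series_cos_coeff' _ _))// ler_expR.
  by rewrite !exprMn ler_wpM2l ?sqr_ge0// -subr_ge0 ltW.
have [iF _ cF] := dominated_convergence measurableT mf_ mf cf ig fg.
have Iint n : (\int[mu]_s f_ n s = (series (fun k => (-1) ^+ k * w ^+ k.*2 / k.*2`!%:R *
    (tpow (k%:R + 1 / 2 + l) (t ^+ 2) * Beta (k%:R + 1 / 2) (l + 1) / 2)) n)%:E)%E.
  under eq_integral do rewrite f_E.
  rewrite integral_sum// /series/= -sumEFin; apply: eq_bigr => k _.
  rewrite integralZl//; last exact: integrable_abelw_kern.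
  by rewrite integral_abelw_kern// subr0 -EFinM.
move: cF; under eq_fun do rewrite Iint.
by rewrite /Rintegral -[X in _ --> X]fineK ?integrable_fin_num// => /fine_cvgP[].
Unshelve. all: by end_near. Qed.

End abel_kernel.

Lemma ae_eq_integrable d (T : measurableType d) (R : realType)
    (mu : {measure set T -> \bar R}) (D : set T) (f g : T -> \bar R) :
  measurable D -> measurable_fun D g -> ae_eq mu D f g ->
  mu.-integrable D f -> mu.-integrable D g.
Proof.
move=> mD mg fg /integrableP[mf foo]; apply/integrableP; split => //.
rewrite (ge0_ae_eq_integral (g := abse \o f)) => //.
- exact: measurableT_comp.
- exact: measurableT_comp.
- by move=> x _; exact: abse_ge0.
- by apply: filterS fg => x /= /[apply] ->.
Qed.

(** * Fubini for the Abel transform *)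

Section abel_fubini.
Context (R : realType).
Local Notation mu := (@lebesgue_measure R).
Local Notation mR := (measurableTypeR R).
Variables (l : R) (a : R -> R).
Hypothesis ma : measurable_fun setT (a : mR -> R).

(** The integral may diverge for some [s], where the value is a mere default; only almost every [s]
    will be controlled. *)
Definition abel_transform s : R := Rintegral mu setT (fun t => a t * kern l t s).

Section weight.
Variables (phi N : R -> R).
Hypothesis mphi : measurable_fun setT (phi : mR -> R).
Hypothesis phiN : forall t, a t != 0 -> (\int[mu]_s (`|phi s| * kern l t s)%:E <= (N t)%:E)%E.
Hypothesis mN : measurable_fun setT (N : mR -> R).
Hypothesis iN : (\int[mu]_t (`|a t| * N t)%:E < +oo)%E.

Let H (z : mR * mR) : \bar R := (a z.2 * (phi z.1 * kern l z.2 z.1))%:E.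

Let mH : measurable_fun setT H.
Proof.
apply/measurable_EFinP; apply: measurable_funM.
  exact: (measurableT_comp ma measurable_snd).
apply: measurable_funM; last exact: measurable_kern2.
exact: (measurableT_comp mphi measurable_fst).
Qed.

Let HN t : (\int[mu]_s `|H (s, t)| <= (`|a t| * N t)%:E)%E.
Proof.
rewrite /H/=; have [->|at0] := eqVneq (a t) 0.
  by rewrite integral0_eq ?normr0 ?mul0r// => s _; rewrite mul0r normr0.
under eq_integral do rewrite /= normrM normrM (ger0_norm (kern_ge0 _ _ _)) EFinM.
rewrite ge0_integralZl; last 4 first.
- by [].
- apply/measurable_EFinP; apply: measurable_funM; last exact: measurable_kern.
  by apply: measurableT_comp; last exact: mphi.
- by move=> s _; rewrite lee_fin mulr_ge0 ?kern_ge0.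
- by rewrite lee_fin.
by rewrite EFinM lee_wpmul2l ?lee_fin// phiN.
Qed.

(** Integrability is tested with [s] as the inner variable: [phiN] bounds the inner integral and
    [iN] the outer one. *)
Let iH : (mu \x mu)%E.-integrable setT H.
Proof.
apply/integrable21ltyP; first exact: mH.
apply: le_lt_trans iN; apply: ge0_le_integral.
- by [].
- by move=> t _; apply: integral_ge0.
- apply: (measurable_fun_fubini_tonelli_G (abse \o H)).
    by apply: measurableT_comp => //; exact: mH.
  by move=> z; exact: abse_ge0.
- apply/measurable_EFinP; apply: measurable_funM; last exact: mN.
  by apply: measurableT_comp; last exact: ma.
by move=> t _; exact: HN.
Qed.

(** Where [phi s] is nonzero, division by it turns the integrability of the section of [H] into that
    of the integrand of the transform; elsewhere both sides vanish. *)
Let aeH : {ae mu, forall s : mR, (\int[mu]_t H (s, t) = (phi s * abel_transform s)%:E)%E}.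
Proof.
apply: filterS (ae_integrable1 iH) => s /= iHs.
have [p0|p0] := eqVneq (phi s) 0.
  by rewrite p0 mul0r integral0_eq// => t _; rewrite /H/= p0 mul0r mulr0.
have ik : mu.-integrable setT (fun t : mR => (a t * kern l t s)%:E).
  apply: eq_integrable (integrableZl measurableT (phi s)^-1 iHs) => // t _.
  by rewrite /H/= -EFinM mulrCA mulKf.
rewrite /abel_transform /Rintegral EFinM fineK ?integrable_fin_num// -integralZl//.
by apply: eq_integral => t _; rewrite /H/= -EFinM mulrCA.
Qed.

Let HaJ t : (\int[mu]_s H (s, t) =
  (a t * Rintegral mu setT (fun s => phi s * kern l t s))%:E)%E.
Proof.
have [a0|a0] := eqVneq (a t) 0.
  by rewrite a0 mul0r integral0_eq// => s _; rewrite /H/= a0 mul0r.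
have ipk : mu.-integrable setT (fun s : mR => (phi s * kern l t s)%:E).
  apply/integrableP; split.
    by apply/measurable_EFinP; apply: measurable_funM => //; exact: measurable_kern.
  apply: le_lt_trans (ltry (N t)); apply: le_trans (phiN a0).
  by under eq_integral do rewrite /= normrM (ger0_norm (kern_ge0 _ _ _)).
by rewrite EFinM fineK ?integrable_fin_num// -integralZl.
Qed.

(** Precedes the hypothesis [mT] because, taken with [phi] constantly 1, it is what yields the
    measurability of the transform. *)
Lemma measurable_fubini_weight :
  measurable_fun setT (fun s : mR => \int[mu]_t (a t * (phi s * kern l t s))%:E)%E.
Proof. exact: measurable_fubini_F iH. Qed.

Hypothesis mT : measurable_fun setT (abel_transform : mR -> R).

Lemma integrable_weight_abel_transform :
  mu.-integrable setT (fun s : mR => (phi s * abel_transform s)%:E).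
Proof.
apply: ae_eq_integrable (integrable_fubini_F iH) => //.
  by apply/measurable_EFinP/measurable_funM.
by apply: filterS aeH => s /= hs _.
Qed.

Lemma Rintegral_weight_abel_transform :
  Rintegral mu setT (fun s => phi s * abel_transform s) =
  Rintegral mu setT (fun t => a t * Rintegral mu setT (fun s => phi s * kern l t s)).
Proof.
transitivity (fine (\int[mu]_s fubini_F mu H s)).
  congr fine; apply: ae_eq_integral => //.
  - by case/integrableP: integrable_weight_abel_transform.
  - exact: measurable_fubini_F iH.
  - by apply: filterS aeH => s /= hs _.
rewrite (Fubini iH) /Rintegral; congr fine; apply: eq_integral => t _.
exact: HaJ.
Qed.

Lemma integrable_Rintegral_weight :
  mu.-integrable setT
    (fun t : mR => (a t * Rintegral mu setT (fun s => phi s * kern l t s))%:E).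
Proof.
have maJ : measurable_fun setT
    (fun t : mR => (a t * Rintegral mu setT (fun s => phi s * kern l t s))%:E).
  by apply: eq_measurable_fun (measurable_fubini_G iH) => t _; rewrite -HaJ.
apply/integrableP; split; first exact: maJ.
apply: le_lt_trans iN; apply: ge0_le_integral.
- by [].
- by move=> t _; exact: abse_ge0.
- by apply: measurableT_comp; last exact: maJ.
- apply/measurable_EFinP; apply: measurable_funM; last exact: mN.
  by apply: measurableT_comp; last exact: ma.
move=> t _; rewrite -HaJ; apply: (le_trans (le_abse_integral _ _ _) (HN t)) => //.
exact: (measurableT_comp mH (measurable_pair2 t)).
Qed.
End weight.
End abel_fubini.

(** * Uniqueness of cosine coefficients *)

Section bernoulli.
Context (R : realType).
Implicit Types (p v th : R).

Lemma bernoulli_ge p n : -1 <= p -> 1 + n%:R * p <= (1 + p) ^+ n.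
Proof.
move=> p1; elim: n => [|n ih]; first by rewrite mul0r addr0 expr0.
rewrite exprS; apply: (@le_trans _ _ ((1 + p) * (1 + n%:R * p))).
  have : 0 <= n%:R * p ^+ 2 by rewrite mulr_ge0 ?sqr_ge0.
  by rewrite -natr1; nra.
by rewrite ler_wpM2l//; lra.
Qed.

(** Bernoulli's inequality for [1 + p], multiplied by [(1 - p) ^+ n], leaves
    [(1 - p ^+ 2) ^+ n <= 1]. *)
Lemma bernoulli_le p n : 0 <= p <= 1 -> (1 - p) ^+ n * (1 + n%:R * p) <= 1.
Proof.
move=> /andP[p0 p1]; apply: (@le_trans _ _ ((1 - p) ^+ n * (1 + p) ^+ n)).
  by rewrite ler_wpM2l ?exprn_ge0 ?subr_ge0// bernoulli_ge//; lra.
rewrite -exprMn exprn_ile1//; first by rewrite mulr_ge0; lra.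
have := sqr_ge0 p; rewrite expr2; nra.
Qed.

(* A polynomial in [v] tending to 1 for [v < th] and to 0 for [th < v <= 1]. *)
Definition step_approx th v n : R := (1 - v ^+ n) ^+ Num.truncn (th ^- n).

Lemma step_approx_itv th v n : 0 <= v <= 1 -> 0 <= step_approx th v n <= 1.
Proof.
move=> /andP[v0 v1]; have /andP[a b] : 0 <= 1 - v ^+ n <= 1.
  by rewrite subr_ge0 exprn_ile1//= gerBl exprn_ge0.
by rewrite /step_approx exprn_ge0//= exprn_ile1.
Qed.

(** The outer exponent is at most [th ^- n], so Bernoulli's inequality bounds the polynomial below
    by [1 - (v / th) ^+ n]. *)
Lemma cvg_step_approx1 th v : 0 <= v < th -> th < 1 ->
  step_approx th v n @[n --> \oo] --> (1 : R).
Proof.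
move=> /andP[v0 vth] th1; have th0 := le_lt_trans v0 vth.
have vt : `|v / th| < 1 by rewrite ger0_norm ?divr_ge0 ?(ltW th0)// ltr_pdivrMr// mul1r.
have vle1 : v <= 1 by rewrite ltW// (lt_trans vth).
apply: (@squeeze_cvgr _ _ _ _ (fun n => 1 - (v / th) ^+ n) (fun=> 1)).
- near=> n; have /andP[_ ->] := step_approx_itv th n (introT andP (conj v0 vle1)).
  rewrite andbT /step_approx; apply: (@le_trans _ _ (1 - (Num.truncn (th ^- n))%:R * v ^+ n)).
    rewrite lerD2l lerN2 expr_div_n mulrC ler_wpM2l ?exprn_ge0//.
    by rewrite truncn_le invr_ge0 exprn_ge0// ltW.
  have := @bernoulli_ge (- v ^+ n) (Num.truncn (th ^- n)).
  by rewrite mulrN; apply; rewrite lerN2 exprn_ile1.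
- rewrite -[X in _ --> X]subr0; apply: cvgB; first exact: cvg_cst.
  exact: cvg_expr.
- exact: cvg_cst.
Unshelve. all: by end_near. Qed.

(** With outer exponent [b], [bernoulli_le] bounds the polynomial by [1 / (1 + b * v ^+ n)], which
    is at most [(th / v) ^+ n]. *)
Lemma cvg_step_approx0 th v : 0 < th < v -> v <= 1 ->
  step_approx th v n @[n --> \oo] --> (0 : R).
Proof.
move=> /andP[th0 thv] v1; have v0 := lt_trans th0 thv.
apply: (@squeeze_cvgr _ _ _ _ (fun=> 0) (fun n => (th / v) ^+ n)).
- near=> n; have /andP[-> _]/= := step_approx_itv th n (introT andP (conj (ltW v0) v1)).
  have vn0 : 0 < v ^+ n by rewrite exprn_gt0.
  have vn1 : 0 <= v ^+ n <= 1 by rewrite ltW//= exprn_ile1// ltW.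
  have := bernoulli_le (Num.truncn (th ^- n)) vn1; rewrite -/(step_approx th v n).
  have h : (v / th) ^+ n <= 1 + (Num.truncn (th ^- n))%:R * v ^+ n.
    rewrite expr_div_n; have := truncnS_gt (th ^- n); rewrite -natr1 => h.
    have : th ^- n * v ^+ n <= ((Num.truncn (th ^- n))%:R + 1) * v ^+ n.
      by rewrite ler_wpM2r// ltW.
    by rewrite mulrDl mul1r mulrC; move: vn1 => /andP[_]; lra.
  have vt0 : 0 < (v / th) ^+ n by rewrite exprn_gt0// divr_gt0.
  move=> h2; have -> : (th / v) ^+ n = ((v / th) ^+ n)^-1 by rewrite -exprVn invf_div.
  rewrite -[leRHS]mul1r ler_pdivlMr//; apply: le_trans h2.
  have /andP[? _] := step_approx_itv th n (introT andP (conj (ltW v0) v1)).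
  by rewrite ler_wpM2l.
- exact: cvg_cst.
- by apply: cvg_expr; rewrite ger0_norm ?divr_ge0 ?ltW// ltr_pdivrMr// mul1r.
Unshelve. all: by end_near. Qed.

End bernoulli.

Section cosine_uniqueness.
Context (R : realType).
Local Notation mu := (@lebesgue_measure R).
Local Notation mR := (measurableTypeR R).
Variables (x : R) (D : R -> R).
Hypothesis x0 : 0 < x.
Hypothesis iD : mu.-integrable setT (fun s : mR => (D s)%:E).
Hypothesis D0 : forall s, ~~ (0 < s <= x) -> D s = 0.

Let theta (s : R) : R := pi * s / x.

Hypothesis Dcos : forall j : nat,
  Rintegral mu setT (fun s => D s * cos (j%:R * (pi / x) * s)) = 0.

(* [good] functions are stable under multiplication by [cos \o theta], since
   [2 cos a cos (j a) = cos ((j + 1) a) + cos ((j - 1) a)]. *)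
Let good (g : R -> R) := [/\ measurable_fun setT (g : mR -> R),
  exists M, forall s, `|g s| <= M &
  forall j : nat, Rintegral mu setT (fun s => D s * (g s * cos (j%:R * theta s))) = 0].

Let mtheta (j : R) : measurable_fun setT (fun s : mR => cos (j * theta s)).
Proof.
apply: (measurableT_comp (continuous_measurable_fun (@continuous_cos R))).
by apply: measurable_funM => //; apply: measurable_funM => //; exact: measurable_funM.
Qed.

Let iDg (g : R -> R) : measurable_fun setT (g : mR -> R) ->
  (exists M, forall s, `|g s| <= M) -> mu.-integrable setT (fun s : mR => (D s * g s)%:E).
Proof.
move=> mg [M gM]; have M0 : 0 <= M by apply: le_trans (gM 0).
apply: le_integrable (integrableZl measurableT M iD) => //.
  apply/measurable_EFinP; apply: measurable_funM => //.
  by apply/measurable_EFinP; case/integrableP: iD.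
by move=> s _; rewrite -EFinM lee_fin !normrM mulrC ler_wpM2r// (le_trans (gM s))// ler_norm.
Qed.

Let good_int g (j : nat) : good g ->
  mu.-integrable setT (fun s : mR => (D s * (g s * cos (j%:R * theta s)))%:E).
Proof.
move=> [mg [M gM] _]; apply: iDg; first exact: measurable_funM.
exists M => s; rewrite normrM -[leRHS]mulr1 ler_pM//.
by rewrite ler_norml cos_geN1 cos_le1.
Qed.

Let good1 : good (fun=> 1).
Proof.
split => //; first by exists 1 => s; rewrite normr1.
move=> j; rewrite -[RHS](Dcos j); apply: eq_Rintegral => s _.
by rewrite mul1r /theta; congr (_ * cos _); field; rewrite gt_eqF.
Qed.

Let goodB a b g h : good g -> good h -> good (fun s => a * g s - b * h s).
Proof.
move=> gg gh; have [mg [M gM] Ig] := gg; have [mh [N hN] Ih] := gh; split.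
- by apply: measurable_funB; exact: measurable_funM.
- exists (`|a| * M + `|b| * N) => s; rewrite (le_trans (ler_normB _ _))//.
  by rewrite !normrM lerD// ler_wpM2l.
move=> j.
transitivity (Rintegral mu setT (fun s => a * (D s * (g s * cos (j%:R * theta s))) -
    b * (D s * (h s * cos (j%:R * theta s))))).
  by apply: eq_Rintegral => s _; ring.
rewrite RintegralB//; last 2 first.
- exact: (integrableZl measurableT a (good_int j gg)).
- exact: (integrableZl measurableT b (good_int j gh)).
by rewrite !RintegralZl ?good_int// Ig Ih !mulr0 subr0.
Qed.

Let good_cos g : good g -> good (fun s => cos (theta s) * g s).
Proof.
move=> gg; have [mg [M gM] Ig] := gg; split.
- apply: measurable_funM => //.
  by apply: eq_measurable_fun (mtheta 1) => s _; rewrite mul1r.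
- exists M => s; rewrite normrM -[leRHS]mul1r ler_pM//.
  by rewrite ler_norml cos_geN1 cos_le1.
(* For [j = 0] there is no lower neighbouring frequency: the product is already the cosine of
   frequency 1. *)
move=> [|j].
  rewrite -[RHS](Ig 1%N); apply: eq_Rintegral => s _.
  by rewrite mul0r cos0 mul1r; ring.
transitivity (Rintegral mu setT (fun s => 2^-1 * (D s * (g s * cos (j.+2%:R * theta s))) +
    2^-1 * (D s * (g s * cos (j%:R * theta s))))).
  apply: eq_Rintegral => s _.
  have -> : j.+2%:R * theta s = j.+1%:R * theta s + theta s by rewrite -(natr1 j.+1); ring.
  have -> : j%:R * theta s = j.+1%:R * theta s - theta s by rewrite -natr1; ring.
  by rewrite cosD cosB; field.
rewrite RintegralD//; last 2 first.
- exact: (integrableZl measurableT 2^-1 (good_int j.+2 gg)).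
- exact: (integrableZl measurableT 2^-1 (good_int j gg)).
by rewrite !RintegralZl ?good_int// !Ig !mulr0 addr0.
Qed.

Let u s : R := (1 - cos (theta s)) / 2.

Let good_ext g h : g =1 h -> good g -> good h.
Proof. by move=> /funext ->. Qed.

Let good_uX n g : good g -> good (fun s => u s ^+ n * g s).
Proof.
move=> gg; elim: n => [|n ih]; first by apply: good_ext gg => s; rewrite mul1r.
apply: good_ext (goodB 2^-1 2^-1 ih (good_cos ih)) => s.
by rewrite /u exprS; ring.
Qed.

Let good_step n b : good (fun s => (1 - u s ^+ n) ^+ b).
Proof.
elim: b => [|b ih]; first exact: good_ext good1.
apply: good_ext (goodB 1 1 ih (good_uX n ih)) => s.
by rewrite exprS; ring.
Qed.

Let u_itv s : 0 <= u s <= 1.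
Proof. by have := cos_le1 (theta s); have := cos_geN1 (theta s); rewrite /u; lra. Qed.

Let u_lt s y : 0 <= s -> s < y -> y <= x -> u s < u y.
Proof.
move=> s0 sy yx; rewrite /u ltr_pM2r// ltrD2l ltrN2.
have thE a : theta a = pi * (a / x) by rewrite /theta mulrA.
have a01 a : 0 <= a <= x -> theta a \in `[0, pi].
  move=> /andP[a0 ax]; rewrite in_itv/= thE mulr_ge0 ?pi_ge0 ?divr_ge0 ?(ltW x0)//=.
  by rewrite -[leRHS]mulr1 ler_wpM2l ?pi_ge0// ler_pdivrMr// mul1r.
rewrite ltr_cos ?a01//.
- by rewrite !thE ltr_pM2l ?pi_gt0// ltr_pM2r// invr_gt0.
- by rewrite s0/= (le_trans (ltW sy)).
- by rewrite yx andbT (le_trans s0)// ltW.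
Qed.

Let integral_lt (y : R) : 0 < y < x -> (\int[mu]_s (D s * (s < y)%R%:R)%:E = 0)%E.
Proof.
move=> /andP[y0 yx].
have uy0 : 0 < u y by have := u_lt (lexx 0) y0 (ltW yx); apply: le_lt_trans; case/andP: (u_itv 0).
have uy1 : u y < 1.
  by have := u_lt (ltW y0) yx (lexx x) => /lt_le_trans; apply; case/andP: (u_itv x).
pose f_ n (s : mR) : \bar R := (D s * step_approx (u y) (u s) n)%:E.
have mf_ n : measurable_fun setT (f_ n).
  have [mg bg _] := good_step n (Num.truncn (u y ^- n)).
  exact: measurable_int (iDg mg bg).
have If_ n : (\int[mu]_s f_ n s = 0)%E.
  have gs := good_step n (Num.truncn (u y ^- n)).
  have [mg bg /(_ 0%N)] := gs.
  rewrite /Rintegral => h; rewrite -[LHS]fineK; last first.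
    by apply: integrable_fin_num => //; exact: iDg.
  transitivity ((0 : R)%:E) => //; congr EFin; rewrite -[RHS]h.
  congr fine; apply: eq_integral => s _.
  by rewrite mul0r cos0 mulr1.
have mlt : measurable_fun setT (fun s : mR => (s < y)%R%:R : R).
  rewrite (_ : (fun _ => _) = (fun s : mR => if s < y then 1 else 0)); last first.
    by apply/funext => s; case: ltP.
  by apply: measurable_fun_ifT => //; exact: measurable_fun_ltr.
have mf : measurable_fun setT (fun s : mR => (D s * (s < y)%R%:R)%:E).
  by apply: measurable_int (iDg mlt _); exists 1 => s; case: ltP => _; rewrite ?normr1 ?normr0.
have cf : {ae mu, forall s : mR, setT s -> f_ ^~ s @ \oo --> (D s * (s < y)%R%:R)%:E}.
  (* At [s = y] the variable equals the threshold and neither limit applies; a single point is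
     negligible. *)
  exists [set y]; split => //; first exact: lebesgue_measure_set1.
  move=> s /= hs; apply: contrapT => /eqP sy; apply: hs => _.
  apply: cvg_EFin; first by near=> n.
  have [/andP[s0 sx]|sx] := boolP (0 < s <= x); last first.
    by rewrite /f_ (D0 sx) mul0r; under eq_fun do rewrite /= mul0r; exact: cvg_cst.
  apply: cvgMr.
  have [sy1|sy1] := ltP s y.
    apply: cvg_step_approx1 => //.
    by rewrite (andP (u_itv s)).1 u_lt// ltW.
  apply: cvg_step_approx0; last by case/andP: (u_itv s).
  rewrite uy0/=; apply: u_lt => //; first exact: ltW.
  by rewrite lt_neqAle eq_sym sy.
have fg : {ae mu, forall (s : mR) n, setT s -> (`|f_ n s| <= `|(D s)%:E|)%E}.
  apply/aeW => s n _; rewrite lee_fin normrM -[leRHS]mulr1 ler_wpM2l//.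
  have /andP[a b] := step_approx_itv (u y) n (u_itv s).
  by rewrite ger0_norm.
have [_ _] := dominated_convergence measurableT mf_ mf cf (integrable_abse iD) fg.
under eq_fun do rewrite If_.
by move=> /cvg_lim => <-//; rewrite lim_cst.
Unshelve. all: by end_near. Qed.

(** The integral of [D] up to any [y] vanishes, and by Lebesgue differentiation [D] is almost
    everywhere the derivative of this primitive. *)
Lemma cosine_uniqueness : {ae mu, forall s, D s = 0}.
Proof.
have F0 y : Rintegral mu `]-oo, y] D = 0.
  rewrite /Rintegral; have [xy|yx] := leP x y.
    (* Beyond [x] the primitive is the whole integral, that is the coefficient of frequency 0. *)
    rewrite integral_itv_if -[RHS](Dcos 0); congr fine; apply: eq_integral => s _.
    rewrite !mul0r cos0 mulr1 in_itv/=; case: leP => // ys.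
    by rewrite D0// negb_and -!ltNge (le_lt_trans xy ys) orbT.
  rewrite -integral_itv_bndo_bndc; last first.
    by apply: measurable_funTS; case/integrableP: iD.
  rewrite integral_itv_if; have [y0|y0] := leP y 0.
    rewrite integral0_eq// => s _; rewrite in_itv/=; case: ltP => // sy.
    by rewrite D0// negb_and -leNgt (le_trans (ltW sy) y0).
  transitivity (fine (\int[mu]_s (D s * (s < y)%R%:R)%:E)).
    congr fine; apply: eq_integral => s _; rewrite in_itv/=.
    by case: ltP => _; rewrite ?mulr1 ?mulr0.
  by rewrite integral_lt ?y0.
have iDy y : mu.-integrable `]-oo, y] (EFin \o D).
  exact: integrableS iD.
have lD : locally_integrable setT D.
  exact: (open_integrable_locally openT iD).
have := FTC1Ny iDy lD; apply: filterS; first exact: (ae_filter_ringOfSetsType mu).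
move=> s [_ <-].
by rewrite (_ : (fun y => _) = cst 0) ?derive1_cst//; apply/funext => y; rewrite F0.
Qed.

End cosine_uniqueness.

Lemma ae_neq (R : realType) (c : R) :
  {ae @lebesgue_measure R, forall s : measurableTypeR R, s != c}.
Proof.
exists [set c]; split; [exact: measurable_set1|exact: lebesgue_measure_set1|].
by move=> s /= /negP; rewrite negbK => /eqP.
Qed.

(** * The Abel integral of the cosine kernel *)

Section abel_inversion.
Context (R : realType).
Local Notation mu := (@lebesgue_measure R).
Local Notation mR := (measurableTypeR R).
Variables (l x : R) (k r : R -> R).
Hypothesis l1 : -1 < l.
Hypothesis x0 : 0 < x.
Hypothesis ik : mu.-integrable `[0, x] (EFin \o k).
Hypothesis ir : mu.-integrable `[0, x] (EFin \o r).

(** The reciprocal of [Beta (1 / 2) (l + 1) / 2], so that Poisson's integral at frequency 0 equals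
    [t ^ (l + 1)]. *)
Definition poisson_cst : R := 2 * Gamma (l + 3 / 2) / (Num.sqrt pi * Gamma (l + 1)).

Definition poisson_integral (w t : R) : R :=
  poisson_cst * tpow (- l) t * Rintegral mu setT (fun s => cos (w * s) * kern l t s).

Hypothesis kr : forall j : nat,
  Rintegral mu `[0, x] (fun t => k t * poisson_integral (j%:R * (pi / x)) t) =
  Rintegral mu `[0, x] (fun s => r s * cos (j%:R * (pi / x) * s)).

Let kx : mR -> R := k \_ `[0, x].
Let a t : R := kx t * tpow (- l) t.
Let T := abel_transform l a.

Let l0 : 0 < l + 1. Proof. by rewrite -ltrBlDr sub0r. Qed.

Let half0 : 0 < 0%:R + 1 / 2 :> R. Proof. by rewrite add0r divr_gt0. Qed.

Let ikx : mu.-integrable setT (fun t : mR => (kx t)%:E).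
Proof.
move: ik; rewrite integrable_mkcond//; apply: eq_integrable => // t _.
by rewrite /kx !patchE; case: ifP.
Qed.

Let mkx : measurable_fun setT kx.
Proof. by apply/measurable_EFinP; case/integrableP: ikx. Qed.

Let ma : measurable_fun setT (a : mR -> R).
Proof. by apply: measurable_funM => //; exact: measurable_tpow. Qed.

Let kx_out t : ~~ (0 <= t <= x) -> kx t = 0.
Proof. by move=> tx; rewrite /kx patchE memNset//= in_itv/=; exact/negP. Qed.

Let a_neq0 t : a t != 0 -> 0 < t <= x.
Proof.
apply: contraTT => tx; rewrite negbK /a.
have [t0|t0] := leP t 0; first by rewrite tpow_le0// mulr0.
by rewrite kx_out ?mul0r//; move: tx; rewrite t0/= (ltW t0).
Qed.

Section weight.
Variables (phi : R -> R) (al c M : R).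
Hypothesis mphi : measurable_fun setT (phi : mR -> R).
Hypothesis al0 : 0 < al.
Hypothesis c0 : 0 <= c.
Hypothesis phi_le : forall s, 0 < s -> `|phi s| <= abelw al c s.
Hypothesis NM : forall t, 0 < t <= x -> tpow (- l) t * tpow (al + l) (t ^+ 2 - c) <= M.

(** The integral against [kern l t] of the majorant [abelw al c] of [phi]. Two cases occur: weights
    bounded by 1, with [al = 1 / 2] and [c = 0], where [abelw] is 1 on the positive half-line; and
    the Abel weight, with [al = n - l - 1] and [c = t0 ^+ 2]. [NM] keeps the product with [t ^ -l]
    bounded, so that the integrability of [k] suffices. *)
Let N t : R := tpow (al + l) (t ^+ 2 - c) * Beta al (l + 1) / 2.

Let B0 : 0 <= Beta al (l + 1) / 2.
Proof. by rewrite divr_ge0// ltW// Beta_gt0. Qed.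

Let N0 t : 0 <= N t. Proof. by rewrite /N -mulrA mulr_ge0// tpow_ge0. Qed.

Let mN : measurable_fun setT (N : mR -> R).
Proof.
apply: measurable_funM => //; apply: measurable_funM => //.
by apply: measurable_tpow_comp; apply: measurable_funB => //; exact: measurable_funX.
Qed.

Let phiN t : a t != 0 -> (\int[mu]_s (`|phi s| * kern l t s)%:E <= (N t)%:E)%E.
Proof.
move=> _; rewrite /N -(integral_abelw_kern t al0 l1 c0); apply: ge0_le_integral => //.
- by move=> s _; rewrite lee_fin mulr_ge0 ?kern_ge0.
- apply/measurable_EFinP; apply: measurable_funM; last exact: measurable_kern.
  exact: measurableT_comp.
- by apply/measurable_EFinP; apply: measurable_funM; [exact: measurable_abelw|exact: measurable_kern].
move=> s _; rewrite lee_fin; have [s0|s0] := leP s 0.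
  by rewrite /kern ltNge s0/= !mulr0.
by rewrite ler_wpM2r ?kern_ge0 ?phi_le.
Qed.

Let iN : (\int[mu]_t (`|a t| * N t)%:E < +oo)%E.
Proof.
have := integrableZl measurableT (M * (Beta al (l + 1) / 2)) ikx.
move=> /integrableP[_]; apply: le_lt_trans; apply: ge0_le_integral => //.
- by move=> t _; rewrite lee_fin mulr_ge0.
- by apply/measurable_EFinP; apply: measurable_funM => //; exact: measurableT_comp.
- by apply: measurableT_comp => //; apply/measurable_EFinP; exact: measurable_funM.
move=> t _; rewrite -EFinM lee_fin.
have [/eqP a00|/a_neq0 tx] := boolP (a t == 0); first by rewrite a00 normr0 mul0r.
have M0 : 0 <= M by apply: le_trans (NM tx); rewrite mulr_ge0 ?tpow_ge0.
rewrite /a /N (normrM _ (tpow _ _)) (ger0_norm (tpow_ge0 _ _)) normrM (ger0_norm (mulr_ge0 M0 B0)).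
rewrite [leLHS](_ : _ = (Beta al (l + 1) / 2 * `|kx t|) *
  (tpow (- l) t * tpow (al + l) (t ^+ 2 - c))); last by ring.
rewrite [leRHS](_ : _ = (Beta al (l + 1) / 2 * `|kx t|) * M); last by ring.
by apply: ler_wpM2l; [exact: mulr_ge0|exact: NM].
Qed.

Lemma measurable_weight :
  measurable_fun setT (fun s : mR => \int[mu]_t (a t * (phi s * kern l t s))%:E)%E.
Proof. exact: (@measurable_fubini_weight R l a ma phi N mphi phiN mN iN). Qed.

Lemma integrable_weight : measurable_fun setT (T : mR -> R) ->
  mu.-integrable setT (fun s : mR => (phi s * T s)%:E).
Proof. exact: (integrable_weight_abel_transform ma mphi phiN mN iN). Qed.

Lemma Rintegral_weight : measurable_fun setT (T : mR -> R) ->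
  Rintegral mu setT (fun s => phi s * T s) =
  Rintegral mu setT (fun t => a t * Rintegral mu setT (fun s => phi s * kern l t s)).
Proof. exact: (Rintegral_weight_abel_transform ma mphi phiN mN iN). Qed.
Lemma integrable_weight_kern :
  mu.-integrable setT
    (fun t : mR => (a t * Rintegral mu setT (fun s => phi s * kern l t s))%:E).
Proof. exact: (integrable_Rintegral_weight ma mphi phiN mN iN). Qed.
End weight.

Let bound0 t : 0 < t <= x -> tpow (- l) t * tpow (0%:R + 1 / 2 + l) (t ^+ 2 - 0) <= x `^ (l + 1).
Proof.
move=> /andP[t0 tx]; rewrite subr0 !tpowE ?exprn_gt0//.
rewrite -powR_mulrn ?(ltW t0)// -powRrM -powRD; last by rewrite (gt_eqF t0) implybT.
have -> : - l + 2%:R * (0%:R + 1 / 2 + l) = l + 1 by field.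
by apply: ge0_ler_powR; rewrite ?nnegrE// ltW.
Qed.

Let abelw0 (s : R) : 0 < s -> abelw (0%:R + 1 / 2) 0 s = 1.
Proof. by move=> s0; rewrite abelw_half s0. Qed.

Let mT : measurable_fun setT (T : mR -> R).
Proof.
have h1 (s : R) : 0 < s -> `|1| <= abelw (0%:R + 1 / 2) 0 s by move=> s0; rewrite abelw0// normr1.
have m1 : measurable_fun setT (fun s : mR => \int[mu]_t (a t * (1 * kern l t s))%:E)%E.
  exact: measurable_weight _ half0 (lexx 0) h1 bound0.
have := measurableT_comp (@fine_measurable R setT measurableT) m1.
apply: eq_measurable_fun => s _; rewrite /= /T /abel_transform /Rintegral.
by congr fine; apply: eq_integral => t _; rewrite mul1r.
Qed.

Let T_out s : ~~ (0 < s <= x) -> T s = 0.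
Proof.
move=> sx; rewrite /T /abel_transform /Rintegral integral0_eq// => t _.
have [/eqP ->|/a_neq0/andP[t0 tx]] := boolP (a t == 0); first by rewrite mul0r.
rewrite /kern; case: ltP => s0; last by rewrite mulr0.
move: sx; rewrite s0/= -ltNge => xs.
rewrite tpow_le0 ?mulr0// subr_le0 ler_pXn2r ?nnegrE ?(ltW t0) ?(ltW s0)//.
by rewrite (le_trans tx)// ltW.
Qed.

Let rx : mR -> R := r \_ `[0, x].
(** Cutting [r] off at [s = 0], a null set, gives [D] the support []0, x]] that [cosine_uniqueness]
    expects. *)
Let D s : R := (if 0 < s then rx s else 0) - poisson_cst * T s.

Let rx_out s : ~~ (0 <= s <= x) -> rx s = 0.
Proof. by move=> sx; rewrite /rx patchE memNset//= in_itv/=; exact/negP. Qed.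

Let rxM (f : R -> R) s : rx s * f s = ((fun s => r s * f s) \_ `[0, x]) s.
Proof. by rewrite /rx !patchE; case: ifP => _ //; rewrite mul0r. Qed.

Let kxM (f : R -> R) t : kx t * f t = ((fun t => k t * f t) \_ `[0, x]) t.
Proof. by rewrite /kx !patchE; case: ifP => _ //; rewrite mul0r. Qed.

Let rx_pos s : s != 0 -> (if 0 < s then rx s else 0) = rx s.
Proof.
by move=> s0; case: ltP => // sn0; rewrite rx_out// negb_and -ltNge lt_neqAle s0 sn0.
Qed.

Let irx : mu.-integrable setT (fun t : mR => (rx t)%:E).
Proof.
move: ir; rewrite integrable_mkcond//; apply: eq_integrable => // t _.
by rewrite /rx !patchE; case: ifP.
Qed.

Let mrx : measurable_fun setT (rx : mR -> R).
Proof. by apply/measurable_EFinP; case/integrableP: irx. Qed.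

Let mpos (f : mR -> R) : measurable_fun setT f ->
  measurable_fun setT (fun s : mR => if 0 < s then f s else 0).
Proof. by move=> mf; apply: measurable_fun_ifT => //; exact: measurable_fun_ltr. Qed.

Let iT1 : mu.-integrable setT (fun s : mR => (1 * T s)%:E).
Proof.
have h1 (s : R) : 0 < s -> `|1| <= abelw (0%:R + 1 / 2) 0 s by move=> s0; rewrite abelw0// normr1.
exact: (integrable_weight _ half0 (lexx 0) h1 bound0 mT).
Qed.

Let irx0 : mu.-integrable setT (fun s : mR => (if 0 < s then rx s else 0)%:E).
Proof.
apply: le_integrable irx => //; first by apply/measurable_EFinP; exact: mpos.
by move=> s _; case: ltP => // _; rewrite lee_fin normr0.
Qed.

Let iD : mu.-integrable setT (fun s : mR => (D s)%:E).
Proof.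
have iT2 := integrableZl measurableT poisson_cst iT1.
apply: eq_integrable (integrableB measurableT irx0 iT2) => // s _.
by rewrite mul1r.
Qed.

Let D0 s : ~~ (0 < s <= x) -> D s = 0.
Proof.
move=> sx; rewrite /D T_out// mulr0 subr0; case: ltP => // s0.
rewrite /rx patchE memNset//= in_itv/=; apply/negP; move: sx.
by rewrite s0 (ltW s0).
Qed.

Let mcos (w : R) : measurable_fun setT (fun s : mR => cos (w * s)).
Proof.
apply: (measurableT_comp (continuous_measurable_fun (@continuous_cos R))).
exact: measurable_funM.
Qed.

Let Dcos (j : nat) : Rintegral mu setT (fun s => D s * cos (j%:R * (pi / x) * s)) = 0.
Proof.
set w := j%:R * (pi / x).
have hw (s : R) : 0 < s -> `|cos (w * s)| <= abelw (0%:R + 1 / 2) 0 s.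
  by move=> s0; rewrite abelw0// ler_norml cos_geN1 cos_le1.
have iTw := integrable_weight (mcos w) half0 (lexx 0) hw bound0 mT.
have ITw := Rintegral_weight (mcos w) half0 (lexx 0) hw bound0 mT.
have irw : mu.-integrable setT (fun s : mR => ((if 0 < s then rx s else 0) * cos (w * s))%:E).
  apply: (le_integrable measurableT _ _ irx0).
    by apply/measurable_EFinP; apply: measurable_funM; [exact: mpos|exact: mcos].
  move=> s _; rewrite !abse_EFin lee_fin normrM; apply: ler_piMr; first exact: normr_ge0.
  by rewrite ler_norml cos_geN1 cos_le1.
transitivity (Rintegral mu setT (fun s => (if 0 < s then rx s else 0) * cos (w * s) -
    poisson_cst * (cos (w * s) * T s))).
  by apply: eq_Rintegral => s _; rewrite /D; ring.
rewrite (RintegralB measurableT irw (integrableZl measurableT poisson_cst iTw)).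
rewrite (RintegralZl _ measurableT iTw) ITw.
rewrite -(RintegralZl _ measurableT (integrable_weight_kern (mcos w) half0 (lexx 0) hw bound0)).
have -> : Rintegral mu setT (fun s => (if 0 < s then rx s else 0) * cos (w * s)) =
    Rintegral mu `[0, x] (fun s => r s * cos (w * s)).
  transitivity (Rintegral mu setT (fun s => rx s * cos (w * s))).
    congr fine; apply: ae_eq_integral; [by []|exact: measurable_int irw| |].
      by apply/measurable_EFinP; apply: measurable_funM; [exact: mrx|exact: mcos].
    apply: filterS (@ae_neq R 0) => s /= s0 _; rewrite (rx_pos s0); reflexivity.
  rewrite [RHS]Rintegral_mkcond; apply: eq_Rintegral => s _; exact: (rxM (fun s => cos (w * s))).
rewrite -(kr j) -/w Rintegral_mkcond; apply/eqP; rewrite subr_eq0; apply/eqP.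
apply: eq_Rintegral => t _; rewrite -(kxM (poisson_integral w)) /a /poisson_integral.
set I := Rintegral _ _ _; ring.
Qed.

(** This is the known formula for the cosine kernel in terms of [K], in its almost everywhere
    form. *)
Let aeD : {ae mu, forall s, D s = 0}.
Proof. exact: cosine_uniqueness x0 iD D0 Dcos. Qed.

Section abel_integral.
Variables (n : nat) (t0 : R).
Hypothesis ln : l + 1 < n%:R.
Hypothesis t0x : 0 < t0 < x.

Let al : R := n%:R - l - 1.

Let al0 : 0 < al. Proof. by rewrite /al -addrA -opprD subr_gt0. Qed.

Let n0 : (0 < n)%N. Proof. by rewrite -(ltr_nat R) (lt_trans l0). Qed.

Let all : al + l = n.-1%:R. Proof. by rewrite /al -{1}(prednK n0) -natr1; ring. Qed.

Let phi := abelw al (t0 ^+ 2).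
(** On [[t0, x]] the monotone function [t ^ -l] is largest at an end point that depends on the sign
    of [l]; the sum of both end values serves in either case. *)
Let M : R := (t0 `^ (- l) + x `^ (- l)) * (x ^+ 2) `^ n.-1%:R.

Let boundM t : 0 < t <= x -> tpow (- l) t * tpow (al + l) (t ^+ 2 - t0 ^+ 2) <= M.
Proof.
move=> /andP[tp tx]; have /andP[t00 t0x'] := t0x; rewrite all.
have [d0|d0] := leP (t ^+ 2 - t0 ^+ 2) 0.
  by rewrite (tpow_le0 _ d0) mulr0 mulr_ge0 ?addr_ge0 ?powR_ge0.
have t0t : t0 <= t by move: d0; rewrite subr_gt0 ltr_pXn2r ?nnegrE ?(ltW tp) ?(ltW t00)// => /ltW.
rewrite !tpowE//; apply: ler_pM; rewrite ?powR_ge0//.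
  have [ll|] := leP 0 (- l).
    rewrite -[leLHS]add0r; apply: lerD; first exact: powR_ge0.
    by apply: ge0_ler_powR; rewrite // nnegrE ltW.
  rewrite oppr_lt0 => ll.
  rewrite -[leLHS]addr0; apply: lerD; last exact: powR_ge0.
  rewrite !powRN lef_pV2 ?posrE ?powR_gt0//.
  by apply: ge0_ler_powR; rewrite ?nnegrE ?(ltW ll) ?(ltW tp) ?(ltW t00).
apply: ge0_ler_powR; rewrite ?nnegrE ?ler0n ?sqr_ge0 ?(ltW d0)//.
by rewrite lerBlDr -[leLHS]addr0 lerD ?sqr_ge0// ler_pXn2r ?nnegrE ?(ltW tp) ?(ltW x0).
Qed.

Let phi_le s : 0 < s -> `|phi s| <= abelw al (t0 ^+ 2) s.
Proof. by move=> _; rewrite ger0_norm// abelw_ge0. Qed.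

Let mphi : measurable_fun setT (phi : mR -> R). Proof. exact: measurable_abelw. Qed.

Let iphiT := integrable_weight mphi al0 (sqr_ge0 t0) phi_le boundM mT.

Let g s : R := (s ^+ 2 - t0 ^+ 2) `^ (n%:R - l - 2) * s * r s.

Let mg : measurable_fun `[t0, x] (g : mR -> R).
Proof.
apply: measurable_funM; last first.
  apply/measurable_EFinP; apply: (measurable_funS _ _ (measurable_int _ ir)) => //.
  by apply: subset_itvr; rewrite bnd_simp; case/andP: t0x => /ltW.
apply: measurable_funTS; apply: measurable_funM => //.
apply: (measurableT_comp (measurable_powR _)).
by apply: measurable_funB => //; exact: measurable_funX.
Qed.

Let g_ae : ae_eq mu setT (fun s : mR => (poisson_cst * (phi s * T s))%:E)
  ((EFin \o g) \_ `[t0, x]).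
Proof.
(* The point [t0] is removed since [tpow] is 0 there, whereas the power in [g] is 1 if its exponent
   is 0. *)
have := @ae_neq R t0; move: aeD.
apply: filterS2; first exact: (ae_filter_ringOfSetsType mu).
move=> s Ds0 st0 _; have /andP[t00 t0x'] := t0x.
have [|sx] := boolP (s \in `[t0, x]); last first.
  rewrite patchE memNset; last exact/negP.
  suff -> : phi s * T s = 0 by rewrite mulr0.
  have [st|ts] := ltP s t0; last first.
    move: sx; rewrite in_itv/= ts/= -ltNge => xs.
    by rewrite T_out ?mulr0// negb_and -!ltNge xs orbT.
  rewrite /phi /abelw; case: ltP => s0; last by rewrite mul0r.
  rewrite tpow_le0 ?mul0r// subr_le0 ler_pXn2r ?nnegrE ?(ltW s0) ?(ltW t00)//.
  exact: ltW.
move=> sx; rewrite patchE mem_set//=; move: sx; rewrite in_itv/= => /andP[t0s sx].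
have s0 : 0 < s by exact: lt_le_trans t0s.
have {}Ds0 : poisson_cst * T s = r s.
  move/eqP: Ds0; rewrite /D s0 subr_eq0 => /eqP <-.
  by rewrite /rx patchE mem_set//= in_itv/= (ltW s0).
congr EFin; rewrite mulrCA Ds0 /phi /abelw s0 /g tpowE.
  by congr (_ `^ _ * _ * _); rewrite /al; ring.
by rewrite subr_gt0 ltr_pXn2r ?nnegrE ?(ltW s0) ?(ltW t00)// lt_neqAle eq_sym st0.
Qed.

Lemma integrable_abel : mu.-integrable `[t0, x] (EFin \o g).
Proof.
apply/integrable_mkcond => //.
apply: ae_eq_integrable g_ae (integrableZl measurableT poisson_cst iphiT) => //.
by apply/(measurable_restrictT (EFin \o g)) => //; exact/measurable_EFinP.
Qed.

Lemma Rintegral_abel : Rintegral mu `[t0, x] g =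
  poisson_cst * (Beta al (l + 1) / 2) *
  Rintegral mu `[t0, x] (fun t => (t ^+ 2 - t0 ^+ 2) ^+ n.-1 * (k t * t `^ (- l))).
Proof.
have iZ := integrableZl measurableT poisson_cst iphiT.
transitivity (Rintegral mu setT (fun s => poisson_cst * (phi s * T s))).
  rewrite /Rintegral integral_mkcond; congr fine; apply/esym/ae_eq_integral => //.
  - exact: measurable_int iZ.
  - by apply/(measurable_restrictT (EFin \o g)) => //; exact/measurable_EFinP.
rewrite (RintegralZl _ measurableT iphiT) -mulrA; congr (_ * _).
rewrite (Rintegral_weight mphi al0 (sqr_ge0 t0) phi_le boundM mT).
have J t : Rintegral mu setT (fun s => phi s * kern l t s) =
    tpow n.-1%:R (t ^+ 2 - t0 ^+ 2) * (Beta al (l + 1) / 2).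
  by rewrite /Rintegral integral_abelw_kern ?sqr_ge0// all /= mulrA.
have B0 : 0 < Beta al (l + 1) / 2.
  by rewrite divr_gt0// Beta_gt0.
have := integrable_weight_kern mphi al0 (sqr_ge0 t0) phi_le boundM.
pose h t := a t * tpow n.-1%:R (t ^+ 2 - t0 ^+ 2).
have aJ t : a t * Rintegral mu setT (fun s => phi s * kern l t s) =
    Beta al (l + 1) / 2 * h t by rewrite J /h; ring.
under eq_fun do rewrite aJ.
move=> /(integrableZl measurableT (Beta al (l + 1) / 2)^-1) ih0.
have ih : mu.-integrable setT (fun t : mR => (h t)%:E).
  apply: eq_integrable ih0 => // t _.
  by rewrite -EFinM mulKf// gt_eqF.
under eq_Rintegral do rewrite aJ.
rewrite (RintegralZl _ measurableT ih); congr (_ * _).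
rewrite /Rintegral [in RHS]integral_mkcond; congr fine.
apply: ae_eq_integral => //; first exact: measurable_int ih.
  apply/(measurable_restrictT (fun t : mR => ((t ^+ 2 - t0 ^+ 2) ^+ n.-1 * (k t * t `^ (- l)))%:E)) => //.
  apply/measurable_EFinP; apply: measurable_funM.
    apply: measurable_funTS; apply: measurable_funX.
    by apply: measurable_funB => //; exact: measurable_funX.
  apply: measurable_funM; last by apply: measurable_funTS; exact: measurable_powR.
  apply/measurable_EFinP; apply: (measurable_funS _ _ (measurable_int _ ik)) => //.
  by apply: subset_itvr; rewrite bnd_simp; case/andP: t0x => /ltW.
have /andP[t00 t0x'] := t0x.
(* Again [t0] is exceptional: for [n = 1] the ordinary power is [0 ^+ 0 = 1], but [tpow] is 0. *)
have := @ae_neq R t0; apply: filterS => t tt0 _.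
rewrite /h /a; have [|tx] := boolP (t \in `[t0, x]); last first.
  rewrite patchE memNset; last exact/negP.
  have [tlt|tge] := ltP t t0; last first.
    by rewrite kx_out ?mul0r//; move: tx; rewrite in_itv/= tge/= negb_and => ->; rewrite orbT.
  have [tp|tn] := ltP 0 t; last by rewrite (tpow_le0 _ tn) mulr0 mul0r.
  rewrite (@tpow_le0 _ n.-1%:R) ?mulr0// subr_le0 ler_pXn2r ?nnegrE ?(ltW tp) ?(ltW t00)//.
  exact: ltW.
move=> tx; rewrite patchE mem_set//=; move: tx; rewrite in_itv/= => /andP[t0t tx].
have tp : 0 < t by exact: lt_le_trans t0t.
have dp : 0 < t ^+ 2 - t0 ^+ 2.
  by rewrite subr_gt0 ltr_pXn2r ?nnegrE ?(ltW tp) ?(ltW t00)// lt_neqAle eq_sym tt0.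
rewrite !tpowE// powR_mulrn ?(ltW dp)// [in RHS]mulrC /kx patchE mem_set//=.
by rewrite in_itv/= (ltW tp).
Qed.

End abel_integral.

End abel_inversion.

(** * Derivatives of the moments *)

Section moment_derivatives.
Context (R : realType).
Local Notation mu := (@lebesgue_measure R).
Local Notation mR := (measurableTypeR R).
Variable x : R.
Implicit Types (h p : R -> R) (t y : R).

Definition moment (j : nat) h t : R :=
  Rintegral mu `[t, x] (fun s => (s ^+ 2 - t ^+ 2) ^+ j * h s).

Definition regular h := (forall t, 0 < t < x -> {for t, continuous h}) /\
  (forall t, 0 < t < x -> mu.-integrable `[t, x] (EFin \o h)).

Lemma regularM p h : continuous p -> regular h -> regular (fun s => p s * h s).
Proof.
move=> cp [ch ih]; split=> [t tx|t tx].
  by apply: cvgM; [exact: cp|exact: ch].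
have /andP[t0 tlex] := tx.
have cap : {within `[t, x], continuous (fun s => `|p s|)}.
  apply: continuous_subspaceT => s; apply: continuous_comp; first exact: cp.
  exact: norm_continuous.
have [c _ pc] := EVT_max (ltW tlex) cap.
apply: (le_integrable _ _ _ (integrableZl _ `|p c| (ih t tx))) => //.
  apply/measurable_EFinP; apply: measurable_funM.
    by apply: measurable_funTS; exact: continuous_measurable_fun.
  by apply/measurable_EFinP; exact: measurable_int (ih t tx).
move=> s sx; rewrite -EFinM !abse_EFin lee_fin !normrM normr_id.
by rewrite ler_wpM2r// pc.
Qed.

Lemma continuous_poly_sqr j y : continuous (fun s : R => (s ^+ 2 - y ^+ 2) ^+ j).
Proof.
move=> s; apply: (@continuous_comp _ _ _ (fun s : R => s ^+ 2 - y ^+ 2) (fun u => u ^+ j)).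
  by apply: cvgB; [exact: exprn_continuous|exact: cvg_cst].
exact: exprn_continuous.
Qed.

(** Splitting off one factor [s^2 - t^2] moves a dependence on [t] out of the integrand, so that
    moments can be differentiated by the product rule instead of under the integral sign. *)
Lemma momentS j h t : regular h -> 0 < t < x ->
  moment j.+1 h t = moment j (fun s => s ^+ 2 * h s) t - t ^+ 2 * moment j h t.
Proof.
move=> rh tx; have r1 := regularM (@continuous_poly_sqr j t) rh.
have r2 := regularM (@exprn_continuous R 2) rh.
have r3 := regularM (@continuous_poly_sqr j t) r2.
rewrite /moment -RintegralZl//; last exact: r1.2.
rewrite -RintegralB//; last 2 first.
- exact: r3.2.
- exact: (integrableZl _ _ (r1.2 t tx)).
by apply: eq_Rintegral => s _; rewrite exprS; ring.
Qed.

Lemma is_derive_moment0 h t : regular h -> 0 < t < x ->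
  is_derive t (1 : R) (moment 0 h) (- h t).
Proof.
move=> [ch ih] tx; have /andP[t0 tlex] := tx.
(* A fixed base point [t / 2] turns the moving lower limit into an upper one, to which the
   fundamental theorem applies. *)
have e0 : 0 < t / 2 by rewrite divr_gt0.
have et : t / 2 < t by rewrite ltr_pdivrMr// ltr_pMr// ltr1n.
have ex : 0 < t / 2 < x by rewrite e0 (lt_trans et).
have [dF F't] := continuous_FTC1_closed tlex (ih _ ex) et (ch t tx).
apply: (@near_eq_is_derive _ _ _ (fun y => Rintegral mu `[t / 2, x] h -
    Rintegral mu `[t / 2, y] h)).
  near=> y; rewrite Rintegral_itvB//; last 3 first.
  - exact: ih.
  - by rewrite bnd_simp ltW//; near: y; exact: lt_nbhsr.
  - by rewrite bnd_simp ltW//; near: y; exact: lt_nbhsl.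
  rewrite Rintegral_itv_obnd_cbnd.
    by apply: eq_Rintegral => s _; rewrite expr0 mul1r.
  have yx : y < x by near: y; exact: lt_nbhsl.
  have y0 : 0 < y by near: y; exact: lt_nbhsr.
  apply: integrableS (ih y _) => //; last by rewrite y0.
  exact: subset_itv_oc_cc.
have dG : is_derive t (1 : R) (fun y => Rintegral mu `[t / 2, y] h) (h t).
  by apply: DeriveDef; [exact: dF|rewrite -derive1E; exact: F't].
apply: is_derive_eq; ring.
Unshelve. all: by end_near. Qed.

(** Product rule on [momentS], by induction with [h] general because [s ^+ 2 * h s] appears as well.
    In the base case the two point values [t ^+ 2 * h t] cancel; later the derivatives recombine
    through [momentS]. *)
Lemma is_derive_momentS j h t : regular h -> 0 < t < x ->
  is_derive t (1 : R) (moment j.+1 h) (- (j.+1%:R * 2 * t * moment j h t)).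
Proof.
elim: j h => [|j ih] h rh tx.
  have r2 := regularM (@exprn_continuous R 2) rh.
  have d0 := is_derive_moment0 rh tx; have d2 := is_derive_moment0 r2 tx.
  apply: (@near_eq_is_derive _ _ _
      (fun y => moment 0 (fun s => s ^+ 2 * h s) y - y ^+ 2 * moment 0 h y)).
    near=> y; rewrite -momentS//; apply/andP; split.
      by near: y; apply: lt_nbhsr; case/andP: tx.
    by near: y; apply: lt_nbhsl; case/andP: tx.
  by apply: is_derive_eq; rewrite /GRing.scale/=; ring.
have r2 := regularM (@exprn_continuous R 2) rh.
have d0 := ih _ rh tx; have d2 := ih _ r2 tx.
apply: (@near_eq_is_derive _ _ _
    (fun y => moment j.+1 (fun s => s ^+ 2 * h s) y - y ^+ 2 * moment j.+1 h y)).
  near=> y; rewrite -momentS//; apply/andP; split.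
    by near: y; apply: lt_nbhsr; case/andP: tx.
  by near: y; apply: lt_nbhsl; case/andP: tx.
apply: is_derive_eq; rewrite /GRing.scale/= (momentS j rh tx) -(natr1 j.+1); ring.
Unshelve. all: by end_near. Qed.

End moment_derivatives.

Local Open Scope complex_scope.

Lemma real_complexME (R : realType) (a b c : R) : a%:C * (b +i* c) = (a * b) +i* (a * c).
Proof. by apply/eqP; rewrite eq_complex/= !mul0r subr0 addr0 !eqxx. Qed.

(** * Iterating [- d / (2 t dt)] on complex-valued functions *)

Section iterated_ddt2.
Context (R : realType).
Variables (x c : R) (h1 h2 : R -> R) (m : nat) (f : R -> R[i]).
Hypothesis rh1 : regular x h1.
Hypothesis rh2 : regular x h2.
Hypothesis fE : forall t, 0 < t < x ->
  f t = (c * moment x m h1 t) +i* (c * moment x m h2 t).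

Let near_itv (t : R) : 0 < t < x -> \forall y \near t, 0 < y < x.
Proof.
move=> /andP[t0 tx]; near=> y; apply/andP; split.
  by near: y; exact: lt_nbhsr.
by near: y; exact: lt_nbhsl.
Unshelve. all: by end_near. Qed.

Let step (g : R -> R[i]) (g1 g2 : R -> R) (d1 d2 t : R) : 0 < t < x ->
  (forall y, 0 < y < x -> g y = g1 y +i* g2 y) ->
  is_derive t (1 : R) g1 d1 -> is_derive t (1 : R) g2 d2 ->
  cderivable g t /\ neg_ddt2 g t = (- (2 * t)^-1 * d1) +i* (- (2 * t)^-1 * d2).
Proof.
move=> tx gE dg1 dg2.
have D1 : is_derive t (1 : R) (fun y => complex.Re (g y)) d1.
  apply: near_eq_is_derive dg1; near=> y; rewrite gE//; near: y; exact: near_itv.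
have D2 : is_derive t (1 : R) (fun y => complex.Im (g y)) d2.
  apply: near_eq_is_derive dg2; near=> y; rewrite gE//; near: y; exact: near_itv.
split; first by split; [case: D1|case: D2].
rewrite /neg_ddt2 /cderive1 !derive1E !derive_val.
by rewrite -rmorphN real_complexME.
Unshelve. all: by end_near. Qed.

(** Each application cancels the inner derivative [2 * t] and brings down the current exponent; the
    exponents multiply to a falling factorial. *)
Lemma iter_neg_ddt2 j t : (j <= m)%N -> 0 < t < x ->
  iter j (@neg_ddt2 R) f t = (c * (m ^_ j)%:R * moment x (m - j) h1 t) +i*
                            (c * (m ^_ j)%:R * moment x (m - j) h2 t).
Proof.
elim: j t => [|j ih] t jm tx; first by rewrite /= fE// subn0 ffactn0 mulr1.
have mj : (m - j = (m - j.+1).+1)%N by rewrite -subSn.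
have dM h : regular x h -> is_derive t (1 : R)
    (fun y => c * (m ^_ j)%:R * moment x (m - j) h y)
    (c * (m ^_ j)%:R * - ((m - j)%:R * 2 * t * moment x (m - j.+1) h t)).
  move=> rh; have := is_derive_momentS (m - j.+1) rh tx; rewrite -mj => dh.
  by apply: is_derive_eq; rewrite /GRing.scale/=; ring.
have t0 : t != 0 by rewrite gt_eqF//; case/andP: tx.
rewrite iterS (step tx (fun y => ih y (ltnW jm)) (dM _ rh1) (dM _ rh2)).2.
by congr (_ +i* _); rewrite ffactnSr natrM; field.
Qed.

Let last_step t : 0 < t < x -> cderivable (iter m (@neg_ddt2 R) f) t /\
  iter m.+1 (@neg_ddt2 R) f t =
  (c * m`!%:R * (2 * t)^-1 * h1 t) +i* (c * m`!%:R * (2 * t)^-1 * h2 t).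
Proof.
move=> tx; have dM h : regular x h -> is_derive t (1 : R)
    (fun y => c * (m ^_ m)%:R * moment x (m - m) h y) (c * (m ^_ m)%:R * - h t).
  move=> rh; have := is_derive_moment0 rh tx; rewrite subnn => dh.
  by apply: is_derive_eq; rewrite /GRing.scale/=; ring.
have [dc e] := step tx (fun y => iter_neg_ddt2 (leqnn m)) (dM _ rh1) (dM _ rh2).
split=> //; rewrite iterS e; congr (_ +i* _); rewrite ffactnn; ring.
Qed.

(** [derive1] has a value even where no derivative exists, so the iterates carry their meaning only
    together with this fact. *)
Lemma cderivable_iter_neg_ddt2 j t : (j <= m)%N -> 0 < t < x ->
  cderivable (iter j (@neg_ddt2 R) f) t.
Proof.
rewrite leq_eqVlt => /predU1P[->|jm] tx; first by case: (last_step tx).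
have mj : (m - j = (m - j.+1).+1)%N by rewrite -subSn.
have dM h : regular x h -> is_derive t (1 : R)
    (fun y => c * (m ^_ j)%:R * moment x (m - j) h y)
    (c * (m ^_ j)%:R * - ((m - j)%:R * 2 * t * moment x (m - j.+1) h t)).
  move=> rh; have := is_derive_momentS (m - j.+1) rh tx; rewrite -mj => dh.
  by apply: is_derive_eq; rewrite /GRing.scale/=; ring.
exact: (step tx (fun y => iter_neg_ddt2 (ltnW jm)) (dM _ rh1) (dM _ rh2)).1.
Qed.

Lemma iter_neg_ddt2S t : 0 < t < x ->
  iter m.+1 (@neg_ddt2 R) f t =
  (c * m`!%:R * (2 * t)^-1 * h1 t) +i* (c * m`!%:R * (2 * t)^-1 * h2 t).
Proof. by move=> tx; case: (last_step tx). Qed.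

End iterated_ddt2.

(** * Poisson's integral for [ytilde] *)

Section poisson_representation.
Local Open Scope complex_scope.
Context (R : realType).
Local Notation mu := (@lebesgue_measure R).
Implicit Types (w t : R).

(** A case of Legendre's duplication formula. It converts the [(2k)!] of the cosine series into the
    [k!] of the Bessel series. *)
Lemma Gamma_half_nat n :
  Gamma (n%:R + 1 / 2 : R) = Num.sqrt pi * n.*2`!%:R / (4 ^+ n * n`!%:R).
Proof.
elim: n => [|n ih]; first by rewrite add0r Gamma_half expr0 !mulr1 divr1.
have f0 k : k`!%:R != 0 :> R by rewrite pnatr_eq0 -lt0n fact_gt0.
have n0 : n.+1%:R != 0 :> R by rewrite pnatr_eq0.
rewrite -natr1 addrAC GammaS ?ltr_wpDl ?divr_gt0// ih doubleS !factS !natrM exprS.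
rewrite -(natr1 n.*2.+1) -(natr1 n.*2) -!(natr1 n) -mul2n natrM.
rewrite -natr1 in n0.
by field; rewrite f0 n0 expf_neq0// pnatr_eq0.
Qed.

Lemma cpow_real w (a : R) : 0 < w -> cpow w%:C a = (w `^ a)%:C.
Proof.
move=> w0; rewrite /cpow /carg /cmod /= expr0n addr0 sqrtr_sqr gtr0_norm// lexx.
rewrite divff ?gt_eqF// acos1.
rewrite /cexp; simpc => /=.
by rewrite ?mulr0 ?mul0r ?subr0 cos0 sin0 /powR gt_eqF//; simpc; rewrite ?mulr1 ?mulr0.
Qed.

Lemma cseries_real (u : nat -> R) : cseries (fun k => (u k)%:C) = (limn (series u))%:C.
Proof.
rewrite /cseries; congr (_ +i* _); rewrite /=.
by rewrite (_ : series _ = fun=> 0) ?lim_cst//; apply/funext => n; rewrite /series/= big1.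
Qed.

(** Comparison of coefficients: [Gamma (k + l + 3 / 2)] is the denominator of the Beta value on the
    right, and [Gamma (k + 1 / 2)] in its numerator is removed by [Gamma_half_nat]. *)
Lemma bessel_term (l w t : R) k : -1 < l -> 0 < w -> 0 < t ->
  Gamma (l + 3 / 2) * 2 `^ (l + 1 / 2) * w `^ (- l - 1 / 2) * Num.sqrt t *
  ((-1) ^+ k / (k`!%:R * Gamma (k%:R + (l + 1 / 2) + 1)) *
   (w * t / 2) `^ (k.*2%:R + (l + 1 / 2))) =
  poisson_cst l * t `^ (- l) * ((-1) ^+ k * w ^+ k.*2 / k.*2`!%:R *
   (tpow (k%:R + 1 / 2 + l) (t ^+ 2) * Beta (k%:R + 1 / 2) (l + 1) / 2)).
Proof.
move=> l1 w0 t0; have l0 : 0 < l + 1 by rewrite -ltrBlDr sub0r.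
have G0 a : 0 < a -> Gamma a != 0 :> R by move=> /Gamma_gt0/gt_eqF ->.
have half0 : 0 < k%:R + 1 / 2 :> R by rewrite ltr_wpDl// divr_gt0.
have sp0 : Num.sqrt pi != 0 :> R by rewrite gt_eqF// sqrtr_gt0 pi_gt0.
have pD (u r s : R) : 0 < u -> u `^ (r + s) = u `^ r * u `^ s.
  by move=> u0; rewrite powRD// (gt_eqF u0) implybT.
have p0 (u r : R) : 0 < u -> u `^ r != 0 by move=> u0; rewrite gt_eqF// powR_gt0.
have wt0 : 0 < w * t / 2 by rewrite divr_gt0// mulr_gt0.
have f0 j : j`!%:R != 0 :> R by rewrite pnatr_eq0 -lt0n fact_gt0.
rewrite (pD (w * t / 2))// powR_mulrn ?(ltW wt0)// expr_div_n exprMn.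
rewrite [(w * t / 2) `^ _]powRM ?mulr_ge0 ?(ltW w0) ?(ltW t0)//.
have pV (u r : R) : 0 <= u -> u^-1 `^ r = (u `^ r)^-1.
  by move=> u0; rewrite -powR_inv1// -powRrM mulN1r powRN.
rewrite powRM ?(ltW w0) ?(ltW t0)// pV//.
have -> : - l - 1 / 2 = - (l + 1 / 2) by ring.
rewrite powRN -(powR12_sqrt (ltW t0)).
have -> : tpow (k%:R + 1 / 2 + l) (t ^+ 2) =
    t ^+ k.*2 * (t `^ 2^-1 * t `^ (l + 1 / 2) * t `^ l).
  rewrite tpowE ?exprn_gt0// -!powR_mulrn ?(ltW t0)// -powRrM -!pD//.
  by congr (_ `^ _); rewrite -mul2n natrM; field.
rewrite powRN.
have -> : 2 ^+ k.*2 = 4 ^+ k :> R by rewrite -mul2n exprM -natrX.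
rewrite /poisson_cst /Beta Gamma_half_nat.
have -> : k%:R + (l + 1 / 2) + 1 = k%:R + 1 / 2 + (l + 1) by ring.
have kl := G0 _ (addr_gt0 half0 l0); have ll := G0 _ l0.
(* Gamma values and powers become variables, leaving [field] a rational identity. *)
move: (Gamma (l + 3 / 2)) (Gamma (l + 1)) (Gamma (k%:R + 1 / 2 + (l + 1))) ll kl => g1 g2 g3 ll kl.
have a1 := p0 2 (l + 1 / 2) (ltr0n _ 2); have a2 := p0 w (l + 1 / 2) w0.
have a3 := p0 t l t0.
move: (2 `^ _) (w `^ _) (t `^ l) a1 a2 a3 => b1 b2 b3 a1 a2 a3.
have a4 : (4 : R) ^+ k != 0 by rewrite expf_neq0.
move: ((-1) ^+ k) (4 ^+ k) a4 (t `^ 2^-1) (t `^ (l + 1 / 2)) => e1 e2 a4 e3 e4.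
move: (w ^+ _) (t ^+ _) => e5 e6.
by field; rewrite ?f0 ?ll ?kl ?a1 ?a2 ?a3 ?a4 ?sp0.
Qed.

(** For nonnegative real frequencies, which include all [j pi / x], the principal powers are real.
    Frequency 0 is a separate case of [ytilde], and at [t = 0] both sides vanish. *)
Lemma ytilde_real (l w t : R) : -1 < l -> 0 <= w -> 0 <= t ->
  ytilde l w%:C t = (poisson_integral l w t)%:C.
Proof.
move=> l1 w0 t0; have l0 : 0 < l + 1 by rewrite -ltrBlDr sub0r.
have G0 a : 0 < a -> Gamma a != 0 :> R by move=> /Gamma_gt0/gt_eqF ->.
have half0 k : 0 < k%:R + 1 / 2 :> R by rewrite ltr_wpDl// divr_gt0.
have sp0 : Num.sqrt pi != 0 :> R by rewrite gt_eqF// sqrtr_gt0 pi_gt0.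
have l32 : 0 < l + 3 / 2 by rewrite (lt_trans l0)// ltrD2l; lra.
have [->|tn0] := eqVneq t 0.
  rewrite /poisson_integral tpow_le0// mulr0 mul0r /ytilde.
  by case: ifP => _; [rewrite powR0 ?gt_eqF|rewrite sqrtr0 mulr0 mul0r].
have {tn0}t0 : 0 < t by rewrite lt_neqAle eq_sym tn0.
rewrite /poisson_integral tpowE//.
have [->|wn0] := eqVneq w 0.
  rewrite /ytilde eqxx; congr (_%:C).
  (* At frequency 0 only the zeroth term of the cosine series remains, a single Beta integral. *)
  rewrite (_ : Rintegral _ _ _ = fine (\int[mu]_s (abelw (0%:R + 1 / 2) 0 s * kern l t s)%:E)%E); last first.
    congr fine; apply: eq_integral => s _; rewrite mul0r cos0 abelw_half /kern.
    by case: ltP => _; rewrite ?mulr0// expr0.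
  rewrite integral_abelw_kern//= subr0 tpowE ?exprn_gt0// -powR_mulrn ?(ltW t0)// -powRrM.
  rewrite [in LHS](_ : l + 1 = - l + 2%:R * (0%:R + 1 / 2 + l)); last by field.
  rewrite powRD; last by rewrite (gt_eqF t0) implybT.
  rewrite /poisson_cst /Beta Gamma_half_nat.
  rewrite (_ : 0%:R + 1 / 2 + (l + 1) = l + 3 / 2); last by field.
  rewrite expr0 fact0; have := G0 _ l0; have := G0 _ l32.
  move: (Gamma _) (Gamma _) => g1 g2 g10 g20.
  by field; rewrite sp0 g10 g20.
have {wn0}w0 : 0 < w by rewrite lt_neqAle eq_sym wn0.
rewrite /ytilde ifF; last by rewrite eq_complex/= (gt_eqF w0).
pose A (k : nat) : R := (-1) ^+ k * w ^+ k.*2 / k.*2`!%:R *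
  (tpow (k%:R + 1 / 2 + l) (t ^+ 2) * Beta (k%:R + 1 / 2) (l + 1) / 2).
have cA := @cvg_series_cos_kern R l w t l1 t0; rewrite -/A in cA.
pose c1 : R := Gamma (l + 3 / 2) * 2 `^ (l + 1 / 2) * w `^ (- l - 1 / 2) * Num.sqrt t.
have c10 : c1 != 0.
  by rewrite /c1 !mulf_neq0 ?G0// ?(gt_eqF (powR_gt0 _ _))// gt_eqF// sqrtr_gt0.
(* Chosen so that the Bessel terms are [c2 * A k]: the convergence of the Bessel series is thus
   inherited from the integrated cosine series, and [c1 * c2] is the factor of Poisson's
   integral. *)
pose c2 : R := poisson_cst l * t `^ (- l) / c1.
have term k : ((-1) ^+ k / (k`!%:R * Gamma (k%:R + (l + 1 / 2) + 1)))%:C *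
    cpow (w%:C * t%:C / 2%:R) (k.*2%:R + (l + 1 / 2)) = (c2 * A k)%:C.
  have -> : w%:C * t%:C / 2%:R = (w * t / 2)%:C :> R[i].
    by rewrite !rmorphM/= fmorphV/= rmorph_nat.
  rewrite cpow_real ?divr_gt0 ?mulr_gt0// -rmorphM; congr (_%:C).
  apply: (mulfI c10); rewrite /c2 [RHS]mulrA (mulrC c1 (_ / _)) divfK//.
  exact: bessel_term.
rewrite cpow_real// /besselJ (_ : (fun k => _ * _) = (fun k => (c2 * A k)%:C)); last first.
  exact/funext.
rewrite cseries_real -!rmorphM; congr (_%:C).
have -> : series (fun k => c2 * A k) = (fun n => c2 * series A n).
  by apply/funext => n; rewrite /series/= mulr_sumr.
have {}cA : c2 * series A n @[n --> \oo] -->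
    c2 * Rintegral mu setT (fun s => cos (w * s) * kern l t s).
  by apply: cvgMr; exact: cA.
rewrite (cvg_lim _ cA)//.
by rewrite -/c1 /c2 mulrA (mulrC c1 (_ / _)) divfK.
Qed.
End poisson_representation.
Local Open Scope complex_scope.

(** * Reduction to real and imaginary parts *)

Section complex_reduction.
Context (R : realType).
Local Notation mu := (@lebesgue_measure R).

Lemma ccos_real (a : R) : ccos a%:C = (cos a)%:C.
Proof.
rewrite /ccos.
have -> : 'i * a%:C = 0 +i* a by rewrite mulrC real_complexME mulr0 mulr1.
have -> : - (0 +i* a) = 0 +i* (- a) :> R[i] by apply/eqP; rewrite eq_complex/= oppr0 !eqxx.
rewrite /cexp/= expR0 !mul1r cosN sinN.
have -> : (cos a +i* sin a) + (cos a +i* - sin a) = (cos a)%:C * 2%:R :> R[i].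
  by rewrite -(rmorph_nat (real_complex R)) -rmorphM; apply/eqP;
     rewrite eq_complex/= subrr mulr_natr mulr2n !eqxx.
by rewrite mulfK// pnatr_eq0.
Qed.

Lemma ReM_real (z : R[i]) (a : R) : complex.Re (z * a%:C) = complex.Re z * a.
Proof. by case: z => u v /=; rewrite mulr0 subr0. Qed.

Lemma ImM_real (z : R[i]) (a : R) : complex.Im (z * a%:C) = complex.Im z * a.
Proof. by case: z => u v /=; rewrite mulr0 add0r. Qed.

Lemma continuous_section (b x : R) (f : R * R -> R) : x <= b ->
  {within [set p : R * R | 0 <= p.2 /\ p.2 <= p.1 <= b], continuous f} ->
  {within `[0, x], continuous (fun t => f (x, t))}.
Proof.
move=> xb /subspace_continuousP cf; apply/subspace_continuousP => t /= tx.
have {}cf : f @ within [set p : R * R | 0 <= p.2 /\ p.2 <= p.1 <= b] (nbhs (x, t)) --> f (x, t).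
  by apply: cf => /=; move: tx; rewrite in_itv/= => /andP[-> ->].
apply: cvg_trans cf.
move=> A; rewrite /= !nbhs_simpl/= => -[/= [U V] [/= Ux Vt] UV].
rewrite /within/=; near=> s; move=> sx.
apply: (UV (x, s)); last by move: sx; rewrite in_itv/= => /andP[-> ->].
split => /=; first exact: nbhs_singleton.
by near: s.
Unshelve. all: by end_near. Qed.

Lemma continuous_powR (a t : R) : 0 < t -> {for t, continuous (fun s : R => s `^ a)}.
Proof.
move=> t0; apply/differentiable_continuous/derivable1_diffP.
by case: (is_derive1_powR a t0).
Qed.

Lemma within_continuous_powR (a t x : R) : 0 < t ->
  {within `[t, x], continuous (fun s : R => s `^ a)}.
Proof.
move=> t0; apply: continuous_in_subspaceT => s; rewrite inE/= in_itv/= => /andP[ts _].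
by apply: continuous_powR; exact: lt_le_trans ts.
Qed.

Lemma regular_powR (k : R -> R) (a x : R) : 0 < x ->
  {within `[0, x], continuous k} -> regular x (fun t => k t * t `^ a).
Proof.
move=> x0 ck; split=> t tx; have /andP[t0 tlex] := tx.
  apply: cvgM.
    by move/(continuous_within_itvP _ x0): ck => [+ _ _]; apply; rewrite in_itv.
  exact: continuous_powR.
apply: continuous_compact_integrable; first exact: segment_compact.
have ckt : {within `[t, x], continuous k}.
  by apply: continuous_subspaceW ck; apply: subset_itvr; rewrite bnd_simp ltW.
move/subspace_continuousP: ckt => ckt.
move/subspace_continuousP: (@within_continuous_powR a t x t0) => cpt.
by apply/subspace_continuousP => s sx; apply: cvgM; [exact: ckt|exact: cpt].
Qed.

End complex_reduction.

Theorem theorem1 (R : realType) (b l : R) (q : R -> R[i])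
    (K Rk : R -> R -> R[i]) (n : nat) (x t : R) :
  0 < b -> - (1 / 2) <= l -> ccontinuous_on `[0, b] q ->
  transmutation_kernel b l q K -> cosine_kernel b l K Rk ->
  l + 1 < n%:R ->
  0 < t -> t < x -> x <= b ->
  [/\ cintegrable `[t, x] (abel_integrand l n (Rk x) t),
      forall k : nat, (k < n)%N ->
        cderivable (iter k (@neg_ddt2 R) (abel_integral l n (Rk x) x)) t &
      K x t =
        (2 * Num.sqrt pi / Gamma (l + 3 / 2))%:C *
        (t `^ (l + 1) / Gamma (n%:R - l - 1))%:C *
        iter n (@neg_ddt2 R) (abel_integral l n (Rk x) x) t].
Proof.
move=> b0 hl _ hK hR ln t0 tx xb.
have x0 : 0 < x by exact: lt_trans tx.
have l1 : -1 < l by lra.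
have l0 : 0 < l + 1 by lra.
have x0b : 0 < x <= b by rewrite x0.
pose k1 s := complex.Re (K x s); pose k2 s := complex.Im (K x s).
have [cK1 cK2] := transmutation_kernel_continuous hK.
have ck1 : {within `[0, x], continuous k1} by exact: (continuous_section xb cK1).
have ck2 : {within `[0, x], continuous k2} by exact: (continuous_section xb cK2).
have ik1 := continuous_compact_integrable (@segment_compact R 0 x) ck1.
have ik2 := continuous_compact_integrable (@segment_compact R 0 x) ck2.
have [ir1 ir2] := cosine_kernel_integrable hR x0b.
have kr (j : nat) : cintegral `[0, x] (fun s => K x s * (poisson_integral l (j%:R * (pi / x)) s)%:C) =
    cintegral `[0, x] (fun s => Rk x s * (cos (j%:R * (pi / x) * s))%:C).
  have w0 : 0 <= j%:R * (pi / x) by rewrite mulr_ge0// divr_ge0 ?pi_ge0// ltW.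
  have := cosine_kernel_representation hR (j%:R * (pi / x))%:C x0b.
  (* Both representations of the perturbed solution start with the same [ytilde]; cancelling it
     equates the two integral terms. *)
  rewrite /utilde => /addrI.
  rewrite /cintegral => -[e1 e2]; congr (_ +i* _).
    apply: (etrans _ (etrans e1 _)); apply: eq_Rintegral => s.
      by rewrite inE/= in_itv/= => /andP[s0 _]; rewrite ytilde_real.
    by move=> _; rewrite -[in LHS]rmorphM ccos_real.
  apply: (etrans _ (etrans e2 _)); apply: eq_Rintegral => s.
    by rewrite inE/= in_itv/= => /andP[s0 _]; rewrite ytilde_real.
  by move=> _; rewrite -[in LHS]rmorphM ccos_real.
have kr1 (j : nat) : Rintegral (@lebesgue_measure R) `[0, x] (fun s => k1 s * poisson_integral l (j%:R * (pi / x)) s) =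
    Rintegral (@lebesgue_measure R) `[0, x] (fun s => complex.Re (Rk x s) * cos (j%:R * (pi / x) * s)).
  move: (kr j) => /(congr1 (@complex.Re R)) /=.
  by under eq_Rintegral do rewrite ReM_real; under [RHS]eq_Rintegral do rewrite ReM_real.
have kr2 (j : nat) : Rintegral (@lebesgue_measure R) `[0, x] (fun s => k2 s * poisson_integral l (j%:R * (pi / x)) s) =
    Rintegral (@lebesgue_measure R) `[0, x] (fun s => complex.Im (Rk x s) * cos (j%:R * (pi / x) * s)).
  move: (kr j) => /(congr1 (@complex.Im R)) /=.
  by under eq_Rintegral do rewrite ImM_real; under [RHS]eq_Rintegral do rewrite ImM_real.
have n0 : (0 < n)%N by rewrite -(ltr_nat R) (lt_trans l0).
(* [m] applications lower the exponent of the moment to 0; one more differentiates an integral with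
   moving lower limit and leaves its integrand. *)
pose m := n.-1; have nE : n = m.+1 by rewrite prednK.
pose c : R := poisson_cst l * (Beta (n%:R - l - 1) (l + 1) / 2).
have txx : 0 < t < x by rewrite t0.
have Re_abel y s : complex.Re (abel_integrand l n (Rk x) y s) =
    (s ^+ 2 - y ^+ 2) `^ (n%:R - l - 2) * s * complex.Re (Rk x s).
  by rewrite /abel_integrand mulrC ReM_real mulrC.
have Im_abel y s : complex.Im (abel_integrand l n (Rk x) y s) =
    (s ^+ 2 - y ^+ 2) `^ (n%:R - l - 2) * s * complex.Im (Rk x s).
  by rewrite /abel_integrand mulrC ImM_real mulrC.
have rh1 := regular_powR (- l) x0 ck1; have rh2 := regular_powR (- l) x0 ck2.
have fE y : 0 < y < x -> abel_integral l n (Rk x) x y =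
    (c * moment x m (fun s => k1 s * s `^ (- l)) y) +i*
    (c * moment x m (fun s => k2 s * s `^ (- l)) y).
  move=> yx; rewrite /abel_integral /cintegral; congr (_ +i* _).
    by under eq_Rintegral do rewrite Re_abel; exact: (Rintegral_abel l1 x0 ik1 ir1 kr1 ln yx).
  by under eq_Rintegral do rewrite Im_abel; exact: (Rintegral_abel l1 x0 ik2 ir2 kr2 ln yx).
split.
- split.
    by apply: eq_integrable (integrable_abel l1 x0 ik1 ir1 kr1 ln txx) => // s _; rewrite /= Re_abel.
  by apply: eq_integrable (integrable_abel l1 x0 ik2 ir2 kr2 ln txx) => // s _; rewrite /= Im_abel.
- move=> j jn; have jm : (j <= m)%N by rewrite -ltnS -nE.
  exact: (cderivable_iter_neg_ddt2 rh1 rh2 fE jm txx).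
rewrite {2}nE (iter_neg_ddt2S rh1 rh2 fE txx) -rmorphM real_complexME.
(* The Beta value is [Gamma (n - l - 1) * Gamma (l + 1) / Gamma n]. Here [Gamma n = m!] cancels the
   factorial produced by the derivatives, and the other Gamma values cancel against [poisson_cst]
   and the prefactors. *)
have cst : 2 * Num.sqrt pi / Gamma (l + 3 / 2) * (t `^ (l + 1) / Gamma (n%:R - l - 1)) *
    (c * m`!%:R * (2 * t)^-1 * t `^ (- l)) = 1.
  have G0 a : 0 < a -> Gamma a != 0 :> R by move=> /Gamma_gt0/gt_eqF ->.
  have sp0 : Num.sqrt pi != 0 :> R by rewrite gt_eqF// sqrtr_gt0 pi_gt0.
  have nl : Gamma (n%:R - l - 1) != 0 by apply: G0; lra.
  have l32 : Gamma (l + 3 / 2) != 0 by apply: G0; lra.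
  have l1' := G0 _ l0.
  have tl : t `^ l != 0 by rewrite gt_eqF// powR_gt0.
  rewrite /c /poisson_cst /Beta.
  have -> : n%:R - l - 1 + (l + 1) = m.+1%:R by rewrite -nE; ring.
  rewrite Gamma_nat powRD; last by rewrite (gt_eqF t0) implybT.
  rewrite powRr1 ?(ltW t0)// powRN.
  have fm : m`!%:R != 0 :> R by rewrite pnatr_eq0 -lt0n fact_gt0.
  move: (Gamma _) (Gamma _) (Gamma _) (Num.sqrt pi) (t `^ l) m`!%:R nl l32 l1' sp0 tl fm.
  move=> g1 g2 g3 g4 g5 g6 h1 h2 h3 h4 h5 h6; have h7 : t != 0 by rewrite gt_eqF.
  by field; rewrite h1 h2 h3 h4 h5 h6 h7.
transitivity (k1 t +i* k2 t); first by rewrite /k1 /k2; case: (K x t).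
have scale (p r s u : R) : p * (r * s) = 1 -> u = p * (r * (u * s)).
  by move=> e; rewrite (mulrCA r) (mulrCA p) e mulr1.
by congr (_ +i* _); exact: scale.
Qed.
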